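(* Let $\varphi:D\to D$ be an analytic self-map of the open unit disc $D$. If $\alpha>0$ and $\alpha\neq1$, then the composition operator $C_\varphi f=f\circ\varphi$ is an isometry on $HB(\alpha)$ if and only if $\varphi$ is a rotation.
   Context: $D=\{z\in\mathbb{C}:|z|<1\}$. For a continuously differentiable complex-valued function $f$ on $D$ ($z=x+iy$), $f_z=\frac12(f_x-if_y)$ and $f_{\bar z}=\frac12(f_x+if_y)$. A twice continuously differentiable $f=u+iv:D\to\mathbb{C}$ is harmonic if $\Delta u=\Delta v=0$. For $\alpha\in(0,\infty)$, the harmonic $\alpha$-Bloch space $HB(\alpha)$ is the complex Banach space of complex-valued harmonic functions $f$ on $D$ with finite norm $$\|f\|=|f(0)|+\sup_{z\in D}(1-|z|^2)^\alpha[|f_z(z)|+|f_{\bar z}(z)|].$$ $C_\varphi$ is an isometry on $HB(\alpha)$ if $\|f\circ\varphi\|=\|f\|$ for all $f\in HB(\alpha)$. A rotation is a map $\varphi(z)=\lambda z$ with $|\lambda|=1$. *)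

(* Defs.v *)
(* A function on the open unit disc is
   represented by a total function on C of which only the values on the disc are
   used: every notion below at a point of the disc depends only on the function
   near that point. *)
From Stdlib Require Import Reals.
From Coquelicot Require Import Coquelicot.
Open Scope R_scope.

Definition disc (z : C) : Prop := Cmod z < 1.

Definition partial_x (u : C -> R) (z : C) : R :=
  Derive (fun t : R => u (t, Im z)) (Re z).

Definition partial_y (u : C -> R) (z : C) : R :=
  Derive (fun t : R => u (Re z, t)) (Im z).

(* [Derive] is total, so existence of the partial derivatives is required
   separately. *)
Definition C1_disc (u : C -> R) : Prop :=
  forall z : C, disc z ->
    ex_derive (fun t : R => u (t, Im z)) (Re z) /\
    ex_derive (fun t : R => u (Re z, t)) (Im z) /\
    continuous (partial_x u) z /\
    continuous (partial_y u) z.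

Definition C2_disc (u : C -> R) : Prop :=
  C1_disc u /\ C1_disc (partial_x u) /\ C1_disc (partial_y u).

Definition laplacian (u : C -> R) (z : C) : R :=
  partial_x (partial_x u) z + partial_y (partial_y u) z.

Definition harmonic_disc (f : C -> C) : Prop :=
  C2_disc (fun z => Re (f z)) /\ C2_disc (fun z => Im (f z)) /\
  forall z : C, disc z ->
    laplacian (fun w => Re (f w)) z = 0 /\ laplacian (fun w => Im (f w)) z = 0.

Definition deriv_x (f : C -> C) (z : C) : C :=
  (partial_x (fun w => Re (f w)) z, partial_x (fun w => Im (f w)) z).

Definition deriv_y (f : C -> C) (z : C) : C :=
  (partial_y (fun w => Re (f w)) z, partial_y (fun w => Im (f w)) z).

Definition deriv_z (f : C -> C) (z : C) : C :=
  (/ 2 * (deriv_x f z - Ci * deriv_y f z))%C.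

Definition deriv_zbar (f : C -> C) (z : C) : C :=
  (/ 2 * (deriv_x f z + Ci * deriv_y f z))%C.

(* The supremum is taken in the extended reals; for z in the disc the base
   1 - |z|^2 is positive, where [Rpower] is the real power. *)
Definition bloch_norm (alpha : R) (f : C -> C) : Rbar :=
  Rbar_plus (Cmod (f 0%C))
    (Lub_Rbar (fun r : R => exists z : C, disc z /\
       r = Rpower (1 - Cmod z ^ 2) alpha *
           (Cmod (deriv_z f z) + Cmod (deriv_zbar f z)))).

Definition HB (alpha : R) (f : C -> C) : Prop :=
  harmonic_disc f /\ is_finite (bloch_norm alpha f).

Definition comp_op (phi f : C -> C) (z : C) : C := f (phi z).

(* The norm is that of the space HB(alpha), so the equality of norms includes
   that the composition operator takes values in that space. *)
Definition isometry_HB (alpha : R) (T : (C -> C) -> C -> C) : Prop :=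
  forall f : C -> C, HB alpha f ->
    HB alpha (T f) /\ bloch_norm alpha (T f) = bloch_norm alpha f.

(* Complex differentiability, i.e. over the field C. *)
Definition analytic_disc (phi : C -> C) : Prop :=
  forall z : C, disc z -> ex_derive (K := C_AbsRing) (V := C_NormedModule) phi z.

Definition self_map_disc (phi : C -> C) : Prop :=
  forall z : C, disc z -> disc (phi z).

Definition rotation_disc (phi : C -> C) : Prop :=
  exists lambda : C, Cmod lambda = 1 /\
    forall z : C, disc z -> phi z = (lambda * z)%C.

(* Main.v *)
(** An isometry maps the function f(z) = z to phi, which is therefore of class
    C^2, and the functions f(z) = z + c force phi(0) = 0.  For every point w of
    the disc some harmonic function a z^(2j+1) + conj (b z^(2j+3)) has a Bloch
    density that is radial and maximal on the circle through w; hence phi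
    contracts the metric |dz| / (1 - |z|^2)^alpha, and comparing lengths of radii
    gives |phi(z)| <= |z|.  By the equality case of the Schwarz lemma it remains
    to see that |phi'(0)| >= 1.

    If alpha > 1, then (1 - |z|^2)^alpha |phi'(z)| has supremum 1, while it is at
    most (1 - |z|^2)^(alpha - 1) by the Schwarz-Pick lemma, so the supremum can
    only be approached at 0.  If alpha < 1, the functions z^n show that |phi|
    has supremum 1; the circle is at finite distance L from 0, so along a radius
    whose image almost reaches the circle the contraction loses almost nothing,
    so max of |phi| on |z| = r is at least r for every r, and |phi'(0)| >= 1. *)

From Stdlib Require Import Reals Lra Psatz FunctionalExtensionality.
From Coquelicot Require Import Coquelicot.
(* Last, because Stdlib's Reals also defines a [disc]. *)
Require Import Defs.
Open Scope R_scope.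

(** * Complex derivatives and Wirtinger derivatives *)

(** A power z^(n+1) has a density whose maximum lies on one circle only, and as n varies these
    circles are countably many; analytic powers alone would therefore test the contraction on too
    few points. The norm adds |f_z| and |f_zbar|, so a conjugated power of a neighbouring degree
    adds its modulus without interference, and its coefficient moves the peak continuously from one
    of these circles to the next. Composition with phi multiplies both Wirtinger moduli by |phi'|,
    so at the peak the common polynomial factor in |phi(z)| cancels and a pure inequality between
    weights remains.

    Lengths are compared through Re (c phi), with |c| = 1 chosen at the end point of the radius,
    since |phi| itself is not differentiable at zeros of phi.

    The Schwarz lemma, its equality case and the Schwarz-Pick bound all come from one identity: the
    mean of exp(-it) g(r exp(it)) over t is r g'(0).

    At alpha = 1 both final arguments break down: the bound (1 - |z|^2)^(alpha - 1) no longer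
    decays, and the circle is infinitely far from 0. *)

Notation is_cderive f z l :=
  (@is_derive C_AbsRing (AbsRing_NormedModule C_AbsRing) f z l).

(** The two normed module structures on the codomain have the same norm [Cmod], and
    differentiability sees nothing else of it. The product and chain rules used below live on the
    ring structure. *)
Lemma is_cderive_of_NormedModule (f : C -> C) (z l : C) :
  is_derive (K := C_AbsRing) (V := C_NormedModule) f z l -> is_cderive f z l.
Proof.
intros [Hl Hd]; split.
- destruct Hl as [H1 H2 H3]; split; assumption.
- intros x Hx eps; exact (Hd x Hx eps).
Qed.

Lemma is_cderive_eps (f : C -> C) (z l : C) :
  is_cderive f z l -> forall eps : posreal, exists delta : posreal,
    forall w : C, Cmod (w - z) < delta ->
      Cmod (f w - f z - (w - z) * l) <= eps * Cmod (w - z).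
Proof.
intros [_ Hd] eps.
destruct (Hd z (fun P HP => HP) eps) as [d Hd'].
exists d; intros w Hw; exact (Hd' w Hw).
Qed.

Lemma Cmod_le_2Rmax (x y : R) : Cmod (x, y) <= 2 * Rmax (Rabs x) (Rabs y).
Proof.
apply Rle_trans with (1 := Cmod_2Rmax (x, y)); simpl.
apply Rmult_le_compat_r.
- apply Rle_trans with (1 := Rabs_pos x); apply Rmax_l.
- rewrite <- (sqrt_pow2 2) at 2 by lra; apply sqrt_le_1_alt; lra.
Qed.

Lemma Rabs_Re_le (z : C) : Rabs (Re z) <= Cmod z.
Proof. apply re_le_Cmod. Qed.

Lemma Rabs_Im_le (z : C) : Rabs (Im z) <= Cmod z.
Proof.
apply Rle_trans with (2 := Rmax_Cmod z); apply Rmax_r.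
Qed.

(** Cauchy-Riemann in total-differential form. Real differentiability is measured in the maximum
    norm, at most a factor 2 away from [Cmod]; the halved [eps] and [d] absorb this factor. *)
Lemma cderive_differentiable_Re (f : C -> C) (x y : R) (l : C) :
  is_cderive f (x, y) l ->
  differentiable_pt_lim (fun u v => Re (f (u, v))) x y (Re l) (- Im l).
Proof.
intros H eps.
destruct (is_cderive_eps _ _ _ H (mkposreal (eps / 2) ltac:(destruct eps; simpl; lra)))
  as [d Hd].
exists (mkposreal (d / 2) ltac:(destruct d; simpl; lra)); simpl.
intros u v Hu Hv.
assert (Hm : Cmod ((u, v) - (x, y)) <= 2 * Rmax (Rabs (u - x)) (Rabs (v - y)))
  by exact (Cmod_le_2Rmax (u - x) (v - y)).
assert (Hd2 : Cmod ((u, v) - (x, y)) < d).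
{ apply Rle_lt_trans with (1 := Hm).
  assert (Rmax (Rabs (u - x)) (Rabs (v - y)) < d / 2) by now apply Rmax_lub_lt.
  lra. }
specialize (Hd _ Hd2); simpl in Hd.
apply Rle_trans with (eps / 2 * Cmod ((u, v) - (x, y))).
- apply Rle_trans with (2 := Hd).
  apply Rle_trans with (2 := Rabs_Re_le _).
  apply Req_le, f_equal; destruct l, (f (u, v)), (f (x, y)); simpl; ring.
- assert (0 < eps) by apply cond_pos; nra.
Qed.

Lemma cderive_differentiable_Im (f : C -> C) (x y : R) (l : C) :
  is_cderive f (x, y) l ->
  differentiable_pt_lim (fun u v => Im (f (u, v))) x y (Im l) (Re l).
Proof.
intros H eps.
destruct (is_cderive_eps _ _ _ H (mkposreal (eps / 2) ltac:(destruct eps; simpl; lra)))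
  as [d Hd].
exists (mkposreal (d / 2) ltac:(destruct d; simpl; lra)); simpl.
intros u v Hu Hv.
assert (Hm : Cmod ((u, v) - (x, y)) <= 2 * Rmax (Rabs (u - x)) (Rabs (v - y)))
  by exact (Cmod_le_2Rmax (u - x) (v - y)).
assert (Hd2 : Cmod ((u, v) - (x, y)) < d).
{ apply Rle_lt_trans with (1 := Hm).
  assert (Rmax (Rabs (u - x)) (Rabs (v - y)) < d / 2) by now apply Rmax_lub_lt.
  lra. }
specialize (Hd _ Hd2); simpl in Hd.
apply Rle_trans with (eps / 2 * Cmod ((u, v) - (x, y))).
- apply Rle_trans with (2 := Hd).
  apply Rle_trans with (2 := Rabs_Im_le _).
  apply Req_le, f_equal; destruct l, (f (u, v)), (f (x, y)); simpl; ring.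
- assert (0 < eps) by apply cond_pos; nra.
Qed.

Lemma is_derive_comp_2d (f : R -> R -> R) (g h : R -> R) (t lx ly dg dh : R) :
  differentiable_pt_lim f (g t) (h t) lx ly ->
  is_derive g t dg -> is_derive h t dh ->
  is_derive (fun s => f (g s) (h s)) t (lx * dg + ly * dh).
Proof.
intros Hf Hg Hh; apply is_derive_Reals, derivable_pt_lim_comp_2d; trivial;
  now apply is_derive_Reals.
Qed.

Lemma is_derive_Re_curve (f : C -> C) (g h : R -> R) (t dg dh : R) (l : C) :
  is_cderive f (g t, h t) l -> is_derive g t dg -> is_derive h t dh ->
  is_derive (fun s => Re (f (g s, h s))) t (Re (l * (dg, dh))).
Proof.
intros Hf Hg Hh; replace (Re (l * (dg, dh))) with (Re l * dg + - Im l * dh)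
  by (simpl; unfold Re, Im; ring).
now apply (is_derive_comp_2d (fun u v => Re (f (u, v))));
  [apply cderive_differentiable_Re| |].
Qed.

Lemma is_derive_Im_curve (f : C -> C) (g h : R -> R) (t dg dh : R) (l : C) :
  is_cderive f (g t, h t) l -> is_derive g t dg -> is_derive h t dh ->
  is_derive (fun s => Im (f (g s, h s))) t (Im (l * (dg, dh))).
Proof.
intros Hf Hg Hh; replace (Im (l * (dg, dh))) with (Im l * dg + Re l * dh)
  by (simpl; unfold Re, Im; ring).
now apply (is_derive_comp_2d (fun u v => Im (f (u, v))));
  [apply cderive_differentiable_Im| |].
Qed.

Lemma partial_of_differentiable (u : C -> R) (z : C) (lx ly : R) :
  differentiable_pt_lim (fun x y => u (x, y)) (Re z) (Im z) lx ly ->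
  is_derive (fun t => u (t, Im z)) (Re z) lx /\
  is_derive (fun t => u (Re z, t)) (Im z) ly.
Proof.
intros H; split.
- replace lx with (lx * 1 + ly * 0) by ring.
  apply (is_derive_comp_2d (fun x y => u (x, y)) (fun t => t) (fun _ => Im z)); trivial.
  + apply (is_derive_id (K := R_AbsRing)).
  + apply (is_derive_const (K := R_AbsRing) (V := R_NormedModule)).
- replace ly with (lx * 0 + ly * 1) by ring.
  apply (is_derive_comp_2d (fun x y => u (x, y)) (fun _ => Re z) (fun t => t)); trivial.
  + apply (is_derive_const (K := R_AbsRing) (V := R_NormedModule)).
  + apply (is_derive_id (K := R_AbsRing)).
Qed.

Lemma partial_Re (f : C -> C) (z l : C) : is_cderive f z l ->
  is_derive (fun t => Re (f (t, Im z))) (Re z) (Re l) /\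
  is_derive (fun t => Re (f (Re z, t))) (Im z) (- Im l).
Proof.
intros H; apply (partial_of_differentiable (fun w => Re (f w))).
apply cderive_differentiable_Re; now destruct z.
Qed.

Lemma partial_Im (f : C -> C) (z l : C) : is_cderive f z l ->
  is_derive (fun t => Im (f (t, Im z))) (Re z) (Im l) /\
  is_derive (fun t => Im (f (Re z, t))) (Im z) (Re l).
Proof.
intros H; apply (partial_of_differentiable (fun w => Im (f w))).
apply cderive_differentiable_Im; now destruct z.
Qed.

(** By Cauchy-Riemann, g contributes nothing to the zbar-derivative and the conjugate of h nothing
    to the z-derivative. *)
Lemma deriv_z_zbar_plus_conj (f g h : C -> C) (z l m : C) :
  (forall w, f w = (g w + Cconj (h w))%C) ->
  is_cderive g z l -> is_cderive h z m ->
  deriv_z f z = l /\ deriv_zbar f z = Cconj m.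
Proof.
intros Hf Hg Hh.
destruct (partial_Re _ _ _ Hg) as [g1 g2]; destruct (partial_Im _ _ _ Hg) as [g3 g4].
destruct (partial_Re _ _ _ Hh) as [h1 h2]; destruct (partial_Im _ _ _ Hh) as [h3 h4].
assert (E : forall w, Re (f w) = Re (g w) + Re (h w) /\ Im (f w) = Im (g w) - Im (h w)).
{ intros w; rewrite Hf; destruct (g w), (h w); simpl; split; ring. }
assert (X1 : partial_x (fun w => Re (f w)) z = Re l + Re m).
{ apply is_derive_unique; eapply is_derive_ext;
    [intros t; symmetry; apply E|]; now apply (is_derive_plus (K := R_AbsRing) (V := R_NormedModule)). }
assert (X2 : partial_x (fun w => Im (f w)) z = Im l - Im m).
{ apply is_derive_unique; eapply is_derive_ext;
    [intros t; symmetry; apply E|]; now apply (is_derive_minus (K := R_AbsRing) (V := R_NormedModule)). }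
assert (Y1 : partial_y (fun w => Re (f w)) z = - Im l + - Im m).
{ apply is_derive_unique; eapply is_derive_ext;
    [intros t; symmetry; apply E|]; now apply (is_derive_plus (K := R_AbsRing) (V := R_NormedModule)). }
assert (Y2 : partial_y (fun w => Im (f w)) z = Re l - Re m).
{ apply is_derive_unique; eapply is_derive_ext;
    [intros t; symmetry; apply E|]; now apply (is_derive_minus (K := R_AbsRing) (V := R_NormedModule)). }
unfold deriv_z, deriv_zbar, deriv_x, deriv_y; rewrite X1, X2, Y1, Y2.
destruct l as [l1 l2], m as [m1 m2]; simpl.
split; unfold Cmult, Cminus, Cplus, Copp, Cinv, Ci, Cconj, RtoC; simpl;
  f_equal; field.
Qed.

(** * Harmonic polynomials and Bloch norms *)

Lemma is_cderive_scal (k : C) (f : C -> C) (z l : C) :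
  is_cderive f z l -> is_cderive (fun w => k * f w)%C z (k * l)%C.
Proof.
intros Hf; replace (k * l)%C with (0 * f z + k * l)%C by ring.
apply (is_derive_mult (K := C_AbsRing) (fun _ => k) f); trivial; [|exact Cmult_comm].
apply (is_derive_const (K := C_AbsRing) (V := AbsRing_NormedModule C_AbsRing)).
Qed.

(** A class of functions closed under differentiation: smoothness and harmonicity of the test
    functions follow from closure, with no second derivative computed. *)
Inductive cpoly : (C -> C) -> Prop :=
| cpoly_const c : cpoly (fun _ => c)
| cpoly_id : cpoly (fun z => z)
| cpoly_plus f g : cpoly f -> cpoly g -> cpoly (fun z => f z + g z)%C
| cpoly_mult f g : cpoly f -> cpoly g -> cpoly (fun z => f z * g z)%C.

Lemma cpoly_cderive (f : C -> C) : cpoly f ->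
  exists f', cpoly f' /\ forall z, is_cderive f z (f' z).
Proof.
induction 1 as [c| |f g Hf [f' [Pf Df]] Hg [g' [Pg Dg]]|f g Hf [f' [Pf Df]] Hg [g' [Pg Dg]]].
- exists (fun _ => 0%C); split; [constructor|intros z].
  apply (is_derive_const (K := C_AbsRing) (V := AbsRing_NormedModule C_AbsRing)).
- exists (fun _ => 1%C); split; [constructor|intros z].
  apply (is_derive_id (K := C_AbsRing)).
- exists (fun z => f' z + g' z)%C; split; [now constructor|intros z].
  now apply (is_derive_plus (K := C_AbsRing) (V := AbsRing_NormedModule C_AbsRing)).
- exists (fun z => f' z * g z + f z * g' z)%C; split; [now repeat constructor|intros z].
  apply (is_derive_mult (K := C_AbsRing)); trivial; exact Cmult_comm.
Qed.

Lemma cpoly_pow (n : nat) : cpoly (fun z => z ^ n)%C.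
Proof.
induction n as [|n IH]; [exact (cpoly_const 1)|].
now apply (cpoly_mult (fun z => z) (fun z => z ^ n)%C); [constructor|].
Qed.

Lemma continuous_Re_cderive (f : C -> C) (z l : C) :
  is_cderive f z l -> continuous (fun w => Re (f w)) z.
Proof.
destruct z as [x y]; intros H.
apply cderive_differentiable_Re in H.
assert (K := differentiable_continuity_pt _ _ _ (ex_intro _ _ (ex_intro _ _ H))).
apply (continuity_2d_pt_filterlim (fun u v => Re (f (u, v)))) in K.
eapply filterlim_ext; [|exact K]; now intros [].
Qed.

(** Both partial derivatives are again real parts of analytic functions, so the lemma can be
    iterated; equality as functions permits rewriting inside a further partial derivative. In
    particular the Laplacian becomes Re F'' + Re (i i F'') = 0. *)
Lemma partial_Re_cpoly (F F' : C -> C) : (forall z, is_cderive F z (F' z)) ->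
  partial_x (fun w => Re (F w)) = (fun w => Re (F' w)) /\
  partial_y (fun w => Re (F w)) = (fun w => Re (Ci * F' w)).
Proof.
intros H; split; apply functional_extensionality; intros z; apply is_derive_unique.
- now apply partial_Re.
- replace (Re (Ci * F' z)) with (- Im (F' z)) by (simpl; unfold Im; ring).
  now apply partial_Re.
Qed.

Lemma C1_disc_Re_cpoly (F : C -> C) : cpoly F -> C1_disc (fun w => Re (F w)).
Proof.
intros H z _; destruct (cpoly_cderive _ H) as [F' [PF' DF]].
destruct (partial_Re_cpoly _ _ DF) as [-> ->].
destruct (partial_Re _ _ _ (DF z)) as [D1 D2].
assert (K : forall G, cpoly G -> continuous (fun w => Re (G w)) z).
{ intros G HG; destruct (cpoly_cderive _ HG) as [G' [_ DG]].
  exact (continuous_Re_cderive _ _ _ (DG z)). }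
repeat split; [eexists; exact D1|eexists; exact D2|now apply K|].
now apply (K (fun w => Ci * F' w)%C); repeat constructor.
Qed.

Lemma harmonic_Re_cpoly (F : C -> C) : cpoly F ->
  C2_disc (fun w => Re (F w)) /\ forall z, laplacian (fun w => Re (F w)) z = 0.
Proof.
intros H; destruct (cpoly_cderive _ H) as [F1 [P1 D1]].
destruct (cpoly_cderive _ P1) as [F2 [P2 D2]].
assert (D1' : forall z, is_cderive (fun w => Ci * F1 w)%C z (Ci * F2 z)%C)
by (intros z; now apply is_cderive_scal).
destruct (partial_Re_cpoly _ _ D1) as [E1 E2].
destruct (partial_Re_cpoly _ _ D2) as [E3 _].
destruct (partial_Re_cpoly _ _ D1') as [_ E4].
split.
- unfold C2_disc; rewrite E1, E2; split; [|split]; try now apply C1_disc_Re_cpoly.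
  apply (C1_disc_Re_cpoly (fun w => Ci * F1 w)%C); now repeat constructor.
- intros z; unfold laplacian; rewrite E1, E2, E3, E4; destruct (F2 z); simpl; ring.
Qed.

Lemma harmonic_cpoly (f g h : C -> C) : cpoly g -> cpoly h ->
  (forall w, f w = (g w + Cconj (h w))%C) -> harmonic_disc f.
Proof.
intros Hg Hh Hf.
assert (E1 : (fun w => Re (f w)) = (fun w => Re (g w + h w)%C))
  by (apply functional_extensionality; intros w; rewrite Hf; reflexivity).
(* Im w = Re (-i w) reduces the imaginary part to the case of real parts; conjugation turns h into
   -h there. *)
assert (E2 : (fun w => Im (f w)) = (fun w => Re ((- Ci) * (g w + (-1) * h w))%C))
  by (apply functional_extensionality; intros w; rewrite Hf; destruct (g w), (h w); simpl; ring).
unfold harmonic_disc; rewrite E1, E2.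
destruct (harmonic_Re_cpoly (fun w => g w + h w)%C) as [A1 A2];
  [now constructor|].
destruct (harmonic_Re_cpoly (fun w => (- Ci) * (g w + (-1) * h w))%C) as [B1 B2];
  [now repeat constructor|].
split; [exact A1|split; [exact B1|now split]].
Qed.

Definition bloch_density (alpha : R) (f : C -> C) (z : C) : R :=
  Rpower (1 - Cmod z ^ 2) alpha * (Cmod (deriv_z f z) + Cmod (deriv_zbar f z)).

Definition bloch_seminorm (alpha : R) (f : C -> C) : Rbar :=
  Lub_Rbar (fun r : R => exists z : C, disc z /\ r = bloch_density alpha f z).

Lemma disc_0 : disc 0.
Proof. unfold disc; rewrite Cmod_0; lra. Qed.

Lemma bloch_seminorm_le (alpha : R) (f : C -> C) (M : R) :
  Rbar_le (bloch_seminorm alpha f) M <->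
  forall z, disc z -> bloch_density alpha f z <= M.
Proof.
unfold bloch_seminorm.
destruct (Lub_Rbar_correct (fun r : R => exists z : C, disc z /\ r = bloch_density alpha f z))
  as [Hub Hlub]; split.
- intros HM z Hz; apply (Rbar_le_trans (bloch_density alpha f z) _ M (Hub _ (ex_intro _ z (conj Hz eq_refl))) HM).
- intros H; apply Hlub; intros r [z [Hz ->]]; now apply H.
Qed.

Lemma bloch_norm_eq (alpha : R) (f : C -> C) :
  bloch_norm alpha f = Rbar_plus (Cmod (f 0%C)) (bloch_seminorm alpha f).
Proof. reflexivity. Qed.

Lemma bloch_seminorm_finite (alpha : R) (f : C -> C) :
  is_finite (bloch_norm alpha f) <-> is_finite (bloch_seminorm alpha f).
Proof.
rewrite bloch_norm_eq; destruct (bloch_seminorm alpha f); simpl; split; easy.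
Qed.

Lemma bloch_norm_finite (alpha : R) (f : C -> C) (M : R) :
  (forall z, disc z -> bloch_density alpha f z <= M) ->
  is_finite (bloch_norm alpha f).
Proof.
intros H; apply bloch_seminorm_finite.
apply bloch_seminorm_le in H.
(* The upper bound excludes only plus infinity; one value of the density excludes minus infinity. *)
assert (H0 : Rbar_le (bloch_density alpha f 0) (bloch_seminorm alpha f)).
{ apply (Lub_Rbar_correct (fun r : R => exists z : C, disc z /\ r = bloch_density alpha f z)).
  exists 0%C; split; [apply disc_0|easy]. }
destruct (bloch_seminorm alpha f); easy.
Qed.

Lemma Cmod_sq_lt1 (z : C) : disc z -> 0 < 1 - Cmod z ^ 2 <= 1.
Proof. unfold disc; intros H; assert (0 <= Cmod z) by apply Cmod_ge_0; nra. Qed.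

Lemma Rpower_le_1 (x a : R) : 0 < x <= 1 -> 0 <= a -> Rpower x a <= 1.
Proof.
intros Hx Ha; rewrite <- (Rpower_O 1) by lra.
replace (Rpower 1 0) with (Rpower 1 a) by (unfold Rpower; rewrite ln_1; f_equal; ring).
now apply Rle_Rpower_l.
Qed.

(* Since the two Wirtinger derivatives are monomials, the Bloch density is radial. *)
Definition test_fun (c : C) (n : nat) (B : R) (m : nat) (z : C) : C :=
  (c + / INR (S n) * z ^ S n + Cconj (B * / INR (S m) * z ^ S m))%C.

Lemma is_cderive_pow (f : C -> C) (z l : C) (n : nat) : is_cderive f z l ->
  is_cderive (fun w => / INR (S n) * f w ^ S n)%C z (f z ^ n * l)%C.
Proof.
intros Hf.
assert (H : is_cderive (fun w => f w ^ S n)%C z (INR (S n) * f z ^ n * l)%C).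
{ induction n as [|n IH].
  - replace (INR 1 * f z ^ 0 * l)%C with l by (simpl; ring).
    eapply is_derive_ext; [|exact Hf]; intros t; simpl; ring.
  - replace (INR (S (S n)) * f z ^ S n * l)%C
      with (l * f z ^ S n + f z * (INR (S n) * f z ^ n * l))%C
      by (rewrite (S_INR (S n)), RtoC_plus, Cpow_S; ring).
    apply (is_derive_mult (K := C_AbsRing)); trivial; exact Cmult_comm. }
replace (f z ^ n * l)%C with (/ INR (S n) * (INR (S n) * f z ^ n * l))%C.
- now apply (is_cderive_scal _ (fun w => f w ^ S n)%C).
- field; intros E; apply RtoC_inj in E; revert E; apply not_0_INR; easy.
Qed.

Lemma deriv_test_fun_comp (c : C) (n : nat) (B : R) (m : nat) (g : C -> C) (z l : C) :
  is_cderive g z l ->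
  deriv_z (fun w => test_fun c n B m (g w)) z = (g z ^ n * l)%C /\
  deriv_zbar (fun w => test_fun c n B m (g w)) z = Cconj (B * (g z ^ m * l))%C.
Proof.
intros Hg; apply (deriv_z_zbar_plus_conj _ (fun w => c + / INR (S n) * g w ^ S n)%C
  (fun w => B * (/ INR (S m) * g w ^ S m))%C).
- intros w; unfold test_fun; now rewrite Cmult_assoc.
- replace (g z ^ n * l)%C with (0 + g z ^ n * l)%C by ring.
  apply (is_derive_plus (K := C_AbsRing) (V := AbsRing_NormedModule C_AbsRing)
    (fun _ => c)); [|now apply is_cderive_pow].
  apply (is_derive_const (K := C_AbsRing) (V := AbsRing_NormedModule C_AbsRing)).
- apply (is_cderive_scal _ (fun w => / INR (S m) * g w ^ S m)%C).
  now apply is_cderive_pow.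
Qed.

(** Both Wirtinger derivatives pick up a factor of modulus |g'(z)|, so it factors out and only
    |g(z)| remains of g. *)
Lemma density_test_fun_comp (alpha : R) (c : C) (n : nat) (B : R) (m : nat)
    (g : C -> C) (z l : C) : 0 <= B -> is_cderive g z l ->
  bloch_density alpha (comp_op g (test_fun c n B m)) z =
  Rpower (1 - Cmod z ^ 2) alpha * Cmod l * (Cmod (g z) ^ n + B * Cmod (g z) ^ m).
Proof.
intros HB Hg; unfold bloch_density, comp_op.
destruct (deriv_test_fun_comp c n B m g z l Hg) as [-> ->].
rewrite Cmod_conj, !Cmod_mult, !Cmod_pow, Cmod_R, Rabs_pos_eq by trivial; ring.
Qed.

Lemma density_test_fun (alpha : R) (c : C) (n : nat) (B : R) (m : nat) (z : C) :
  0 <= B ->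
  bloch_density alpha (test_fun c n B m) z =
  Rpower (1 - Cmod z ^ 2) alpha * (Cmod z ^ n + B * Cmod z ^ m).
Proof.
intros HB.
pose proof (density_test_fun_comp alpha c n B m (fun w => w) z 1 HB
  (is_derive_id (K := C_AbsRing) z)) as H.
rewrite Cmod_1, Rmult_1_r in H; exact H.
Qed.

Lemma HB_test_fun (alpha : R) (c : C) (n : nat) (B : R) (m : nat) :
  0 < alpha -> 0 <= B -> HB alpha (test_fun c n B m).
Proof.
intros Ha HB; split.
- apply (harmonic_cpoly _ (fun z => c + / INR (S n) * z ^ S n)%C
    (fun z => B * / INR (S m) * z ^ S m)%C); try easy.
  + apply cpoly_plus; [constructor|].
    now apply (cpoly_mult (fun _ => / INR (S n))%C _); [constructor|apply cpoly_pow].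
  + now apply (cpoly_mult (fun _ => B * / INR (S m))%C _); [constructor|apply cpoly_pow].
- apply bloch_norm_finite with (1 * (1 + B)); intros z Hz.
  rewrite density_test_fun by trivial.
  assert (P : forall k, 0 <= Cmod z ^ k <= 1).
  { intros k; split; [apply pow_le, Cmod_ge_0|].
    rewrite <- (pow1 k); apply pow_incr; split; [apply Cmod_ge_0|].
    now apply Rlt_le. }
  pose proof (P n); pose proof (P m).
  apply Rmult_le_compat; try nra.
  + apply Rlt_le, exp_pos.
  + apply Rpower_le_1; [now apply Cmod_sq_lt1|lra].
Qed.

(** Once phi fixes 0 the terms |f(0)| cancel and the suprema agree. In terms of bounds M, one
    direction gives the contraction; the other shows that phi cannot shrink densities uniformly. *)
Lemma isometry_seminorm_le (alpha : R) (phi f : C -> C) (M : R) :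
  isometry_HB alpha (comp_op phi) -> phi 0%C = 0%C -> HB alpha f ->
  ((forall z, disc z -> bloch_density alpha (comp_op phi f) z <= M) <->
   (forall z, disc z -> bloch_density alpha f z <= M)).
Proof.
intros Hi H0 Hf; rewrite <- !bloch_seminorm_le.
destruct (Hi f Hf) as [[_ Hc] E]; destruct Hf as [_ Hf].
apply bloch_seminorm_finite in Hc; apply bloch_seminorm_finite in Hf.
rewrite !bloch_norm_eq in E; unfold comp_op at 1 in E; rewrite H0 in E.
rewrite <- Hc, <- Hf in E |- *; simpl in E |- *.
injection E as E; split; lra.
Qed.

(** The seminorms of c + z and c + phi do not depend on c, so |c + phi(0)| - |c| is constant in c.
    The values c = 0 and c = -phi(0) give |phi(0)| = -|phi(0)|. *)
Lemma isometry_fix0 (alpha : R) (phi : C -> C) :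
  0 < alpha -> (forall z, disc z -> exists l, is_cderive phi z l) ->
  isometry_HB alpha (comp_op phi) -> phi 0%C = 0%C.
Proof.
intros Ha Hphi Hi.
assert (S : forall c, bloch_seminorm alpha (test_fun c 0 0 0)
  = bloch_seminorm alpha (test_fun 0 0 0 0) /\
  bloch_seminorm alpha (comp_op phi (test_fun c 0 0 0))
  = bloch_seminorm alpha (comp_op phi (test_fun 0 0 0 0))).
{ intros c; split; apply Lub_Rbar_eqset; intros r; split; intros [z [Hz ->]];
    exists z; split; trivial.
  1, 2 : now rewrite !density_test_fun by lra.
  all : destruct (Hphi z Hz) as [l Hl];
    now rewrite !(density_test_fun_comp _ _ _ _ _ phi z l) by (trivial; lra). }
assert (V : forall c z, test_fun c 0 0 0 z = (c + z)%C)
  by (intros c z; unfold test_fun, Cconj, Cplus, Cmult; simpl; f_equal; field).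
assert (N : forall c, Cmod (c + phi 0%C) + real (bloch_seminorm alpha (comp_op phi (test_fun 0 0 0 0)))
  = Cmod c + real (bloch_seminorm alpha (test_fun 0 0 0 0))).
{ intros c; destruct (HB_test_fun alpha c 0 0 0 Ha (Rle_refl 0)) as [Hh Hf].
  destruct (Hi _ (conj Hh Hf)) as [[_ Hc] E].
  apply bloch_seminorm_finite in Hc; apply bloch_seminorm_finite in Hf.
  rewrite !bloch_norm_eq in E; unfold comp_op at 1 in E; rewrite !V in E.
  destruct (S c) as [S1 S2]; rewrite S1 in Hf, E; rewrite S2 in Hc, E.
  rewrite Cplus_0_r in E; rewrite <- Hc, <- Hf in E; now injection E as E. }
pose proof (N 0%C) as N1; pose proof (N (- phi 0)%C) as N2.
rewrite Cplus_0_l, Cmod_0 in N1.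
replace (- phi 0 + phi 0)%C with (RtoC 0) in N2 by ring; rewrite Cmod_opp, Cmod_0 in N2.
apply Cmod_eq_0; lra.
Qed.

(** * Contraction of the weighted metric *)

Lemma le_exp_pred (x : R) : x <= exp (x - 1).
Proof. pose proof (exp_ineq1_le (x - 1)); lra. Qed.

(* The tangent bound [x <= exp (x - 1)] applied to s/s0, (1+Bs)/(1+B s0) and
   (1-s)/(1-s0): B and j are chosen so that the three exponents cancel, i.e. s0
   is the critical point of the log-concave function. *)
Lemma radial_peak (alpha s0 : R) : 0 < alpha -> 0 < s0 < 1 ->
  exists (j : nat) (B : R), 0 <= B /\ forall s, 0 <= s < 1 ->
    Rpower (1 - s) alpha * (s ^ j + B * s ^ S j) <=
    Rpower (1 - s0) alpha * (s0 ^ j + B * s0 ^ S j).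
Proof.
intros Ha Hs0.
assert (Ht : 0 <= alpha * s0 / (1 - s0)).
{ apply Rmult_le_pos; [nra|apply Rlt_le, Rinv_0_lt_compat; lra]. }
(* In the variable s, criticality at s0 reads alpha s0 / (1 - s0) = j + B s0 / (1 + B s0). The last
   term ranges over [0, 1), so j is the integer part of the left side, k its fractional part, and B
   solves B s0 / (1 + B s0) = k. *)
destruct (nfloor_ex _ Ht) as [j [Hj1 Hj2]].
set (k := alpha * s0 / (1 - s0) - INR j).
assert (Hk : 0 <= k < 1) by (unfold k; lra).
set (B := k / ((1 - k) * s0)).
assert (HB : 0 <= B).
{ apply Rmult_le_pos; [lra|apply Rlt_le, Rinv_0_lt_compat; nra]. }
assert (HBs : 1 + B * s0 = / (1 - k)) by (unfold B; field; lra).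
exists j, B; split; trivial; intros s Hs.
set (d := s - s0).
assert (E1 : s ^ j <= s0 ^ j * exp (INR j * (d / s0))).
{ replace (exp (INR j * (d / s0))) with (exp (d / s0) ^ j)
    by (rewrite <- Rpower_pow by apply exp_pos; unfold Rpower; now rewrite ln_exp).
  rewrite <- Rpow_mult_distr; apply pow_incr; split; [lra|].
  replace s with (s0 * (s / s0)) at 1 by (field; lra).
  apply Rmult_le_compat_l; [lra|].
  replace (d / s0) with (s / s0 - 1) by (unfold d; field; lra); apply le_exp_pred. }
assert (E2 : 1 + B * s <= (1 + B * s0) * exp (k * (d / s0))).
{ assert (0 < / (1 - k)) by (apply Rinv_0_lt_compat; lra).
  replace (1 + B * s) with ((1 + B * s0) * ((1 + B * s) / (1 + B * s0)))
    by (field; lra).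
  apply Rmult_le_compat_l; [lra|].
  replace (k * (d / s0)) with ((1 + B * s) / (1 + B * s0) - 1)
    by (rewrite HBs; unfold B, d; field; lra); apply le_exp_pred. }
assert (E3 : Rpower (1 - s) alpha <=
  Rpower (1 - s0) alpha * exp (- alpha * (d / (1 - s0)))).
{ apply Rle_trans with (Rpower ((1 - s0) * exp (- (d / (1 - s0)))) alpha).
  - apply Rle_Rpower_l; [lra|split; [lra|]].
    replace (1 - s) with ((1 - s0) * ((1 - s) / (1 - s0))) by (field; lra).
    apply Rmult_le_compat_l; [lra|].
    replace (- (d / (1 - s0))) with ((1 - s) / (1 - s0) - 1)
      by (unfold d; field; lra); apply le_exp_pred.
  - rewrite <- Rpower_mult_distr by (try apply exp_pos; lra).
    apply Req_le, f_equal; unfold Rpower at 1; rewrite ln_exp; f_equal; ring. }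
assert (P : forall x y, x ^ j + y * x ^ S j = x ^ j * (1 + y * x))
  by (intros; simpl; ring).
rewrite !P.
assert (0 <= s ^ j) by (apply pow_le; lra).
assert (0 <= 1 + B * s) by nra.
apply Rle_trans with ((Rpower (1 - s0) alpha * exp (- alpha * (d / (1 - s0)))) *
  ((s0 ^ j * exp (INR j * (d / s0))) * ((1 + B * s0) * exp (k * (d / s0))))).
- apply Rmult_le_compat; trivial.
  + apply Rlt_le, exp_pos.
  + now apply Rmult_le_pos.
  + now apply Rmult_le_compat.
- apply Req_le.
  transitivity (Rpower (1 - s0) alpha * (s0 ^ j * (1 + B * s0)) *
    (exp (- alpha * (d / (1 - s0))) * exp (INR j * (d / s0)) * exp (k * (d / s0))));
    [ring|].
  rewrite <- !exp_plus.
  replace (- alpha * (d / (1 - s0)) + INR j * (d / s0) + k * (d / s0)) with 0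
    by (unfold k; field; lra).
  rewrite exp_0; ring.
Qed.

Lemma isometry_contracts (alpha : R) (phi phi' : C -> C) :
  0 < alpha -> (forall z, disc z -> is_cderive phi z (phi' z)) ->
  self_map_disc phi -> isometry_HB alpha (comp_op phi) -> phi 0%C = 0%C ->
  forall z, disc z ->
  Rpower (1 - Cmod z ^ 2) alpha * Cmod (phi' z) <= Rpower (1 - Cmod (phi z) ^ 2) alpha.
Proof.
intros Ha Hd Hs Hi H0 z Hz.
(* The peak lemma needs a positive radius; at 0 the identity function already has its maximal
   density, namely 1. *)
destruct (Ceq_dec (phi z) 0%C) as [E|E].
- rewrite E, Cmod_0.
  replace (Rpower (1 - 0 ^ 2) alpha) with 1
    by (replace (1 - 0 ^ 2) with 1 by ring; unfold Rpower; rewrite ln_1, Rmult_0_r, exp_0; easy).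
  pose proof (proj2 (isometry_seminorm_le _ _ _ 1 Hi H0
    (HB_test_fun alpha 0 0 0 0 Ha (Rle_refl 0)))) as H.
  cut (bloch_density alpha (comp_op phi (test_fun 0 0 0 0)) z <= 1).
  + rewrite (density_test_fun_comp _ _ _ _ _ _ z (phi' z)) by (auto; lra).
    simpl; lra.
  + apply H; trivial; intros w Hw; rewrite density_test_fun by lra; simpl.
    pose proof (Rpower_le_1 _ alpha (Cmod_sq_lt1 w Hw)) as K; simpl in K; lra.
- assert (Hp : 0 < Cmod (phi z) < 1) by (split; [now apply Cmod_gt_0|now apply Hs]).
  assert (Hs0 : 0 < Cmod (phi z) ^ 2 < 1) by nra.
  destruct (radial_peak alpha _ Ha Hs0) as [j [B [HB Hj]]].
  (* The peak was found in the variable s = |w|^2, hence the doubled exponents. The positive factor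
     depending on |phi(z)| is cancelled at the end. *)
  pose proof (proj2 (isometry_seminorm_le _ _ _ _ Hi H0
    (HB_test_fun alpha 0 (2 * j) B (2 * S j) Ha HB))
    (fun w Hw => ltac:(rewrite density_test_fun, !pow_mult by trivial;
        apply Hj; pose proof (Cmod_sq_lt1 w Hw); lra)) z Hz) as K.
  rewrite (density_test_fun_comp _ _ _ _ _ _ z (phi' z)), !pow_mult in K by auto.
  apply Rmult_le_reg_r with (2 := K).
  apply Rplus_lt_le_0_compat; [now apply pow_lt|].
  apply Rmult_le_pos; trivial; apply pow_le; lra.
Qed.

Lemma RtoC_mult_pair (r : R) (e : C) : (r * e)%C = (r * Re e, r * Im e).
Proof. destruct e; unfold Cmult; simpl; f_equal; ring. Qed.

Lemma is_derive_Re_radius (f f' : C -> C) (c e : C) (r : R) :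
  (forall z, disc z -> is_cderive f z (f' z)) -> Cmod e = 1 -> Rabs r < 1 ->
  is_derive (fun t : R => Re (c * f (t * e)%C)) r (Re (c * (f' (r * e)%C * e))).
Proof.
intros Hf He Hr.
assert (D : is_cderive (fun w => c * f w)%C (r * Re e, r * Im e) (c * f' (r * e)%C)%C).
{ apply is_cderive_scal.
  rewrite <- RtoC_mult_pair.
  apply Hf; unfold disc; rewrite Cmod_mult, Cmod_R, He; lra. }
assert (L : forall k, is_derive (fun t : R => t * k) r k)
  by (intros k; auto_derive; [easy|ring]).
pose proof (is_derive_Re_curve _ _ _ r _ _ _ D (L (Re e)) (L (Im e))) as H.
replace (c * (f' (r * e)%C * e))%C with (c * f' (r * e)%C * (Re e, Im e))%C
  by (destruct e; simpl; ring).
eapply is_derive_ext; [|exact H].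
intros t; cbv beta; now rewrite <- RtoC_mult_pair.
Qed.

(* [rho] measures the length of radii for the metric |dz| / (1 - |z|^2)^alpha. *)
Lemma radial_length_nonincreasing (alpha : R) (phi phi' : C -> C) (rho : R -> R)
    (c e : C) (a b : R) :
  (forall z, disc z -> is_cderive phi z (phi' z)) -> self_map_disc phi ->
  0 < alpha ->
  (forall z, disc z ->
    Rpower (1 - Cmod z ^ 2) alpha * Cmod (phi' z) <= Rpower (1 - Cmod (phi z) ^ 2) alpha) ->
  (forall x, -1 < x < 1 -> is_derive rho x (Rpower (1 - x ^ 2) (- alpha))) ->
  Cmod c = 1 -> Cmod e = 1 -> 0 <= a <= b -> b < 1 ->
  rho (Re (c * phi (b * e)%C)) - rho b <= rho (Re (c * phi (a * e)%C)) - rho a.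
Proof.
intros Hd Hs Ha Hc Hrho Hcm Hem Hab Hb.
set (q (t : R) := Re (c * phi (t * e)%C)).
set (dF (t : R) := Re (c * (phi' (t * e)%C * e)) * Rpower (1 - q t ^ 2) (- alpha)
             - Rpower (1 - t ^ 2) (- alpha)).
assert (T : forall t, a <= t <= b -> disc (t * e)%C /\ Cmod (t * e)%C = t).
{ intros t Ht; assert (M : Cmod (t * e)%C = t)
    by (rewrite Cmod_mult, Cmod_R, Hem, Rabs_pos_eq; lra).
  split; trivial; unfold disc; rewrite M; lra. }
assert (Q : forall t, a <= t <= b -> q t ^ 2 <= Cmod (phi (t * e)%C) ^ 2 /\ Cmod (phi (t * e)%C) ^ 2 < 1).
{ intros t Ht; destruct (T t Ht) as [T1 _].
  assert (A : Rabs (q t) <= Cmod (phi (t * e)%C)).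
  { unfold q; rewrite <- (Rmult_1_l (Cmod (phi _))), <- Hcm, <- Cmod_mult; apply Rabs_Re_le. }
  pose proof (Hs _ T1) as A1; unfold disc in A1.
  pose proof (Rabs_pos (q t)); rewrite <- (pow2_abs (q t)); split; nra. }
assert (D : forall t, a <= t <= b -> is_derive (fun t => rho (q t) - rho t) t (dF t)).
{ intros t Ht; destruct (Q t Ht).
  apply (is_derive_minus (K := R_AbsRing) (V := R_NormedModule) (fun t => rho (q t)) rho);
    [|apply Hrho; lra].
  apply (is_derive_comp (K := R_AbsRing) (V := R_NormedModule) rho q).
  - apply Hrho; split; nra.
  - apply is_derive_Re_radius; trivial; rewrite Rabs_pos_eq; lra. }
assert (N : forall t, a <= t <= b -> dF t <= 0).
{ intros t Ht; destruct (Q t Ht) as [Q1 Q2]; destruct (T t Ht) as [T1 T2].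
  unfold dF; specialize (Hc _ T1); rewrite T2 in Hc.
  rewrite !Rpower_Ropp.
  assert (P1 : 0 < Rpower (1 - t ^ 2) alpha) by apply exp_pos.
  assert (P2 : 0 < Rpower (1 - q t ^ 2) alpha) by apply exp_pos.
  (* Passing from phi to the real part [q] only increases the weight, so the contraction survives
     the projection. *)
  assert (L : Rpower (1 - Cmod (phi (t * e)%C) ^ 2) alpha <= Rpower (1 - q t ^ 2) alpha)
    by (apply Rle_Rpower_l; lra).
  assert (R1 : Re (c * (phi' (t * e)%C * e)) <= Cmod (phi' (t * e)%C)).
  { apply Rle_trans with (1 := Rle_abs _); apply Rle_trans with (1 := Rabs_Re_le _).
    rewrite !Cmod_mult, Hcm, Hem; lra. }
  apply Rmult_le_reg_r with (Rpower (1 - t ^ 2) alpha * Rpower (1 - q t ^ 2) alpha);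
    [now apply Rmult_lt_0_compat|].
  rewrite Rmult_0_l.
  replace (_ * _) with (Rpower (1 - t ^ 2) alpha * Re (c * (phi' (t * e)%C * e)) -
    Rpower (1 - q t ^ 2) alpha) by (field; lra).
  nra. }
destruct (Req_dec a b) as [->|Hne]; [apply Rle_refl|].
destruct (MVT_gen (fun t => rho (q t) - rho t) a b dF) as [t [Ht E]].
- intros t Ht; rewrite Rmin_left, Rmax_right in Ht by lra; apply D; lra.
- intros t Ht; rewrite Rmin_left, Rmax_right in Ht by lra.
  apply continuity_pt_filterlim, (ex_derive_continuous (fun t => rho (q t) - rho t)).
  exists (dF t); now apply D.
- rewrite Rmin_left, Rmax_right in Ht by lra.
  pose proof (N t Ht); unfold q in E |- *; nra.
Qed.

(** The primitive is taken on all of (-1, 1) because the projected point Re (c phi) may be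
    negative. *)
Lemma radial_length_exists (alpha : R) : exists rho : R -> R,
  forall x, -1 < x < 1 -> is_derive rho x (Rpower (1 - x ^ 2) (- alpha)).
Proof.
exists (fun x => RInt (fun t => Rpower (1 - t ^ 2) (- alpha)) 0 x); intros x Hx.
assert (K : forall y, -1 < y < 1 -> continuous (fun t => Rpower (1 - t ^ 2) (- alpha)) y).
{ intros y Hy; apply (ex_derive_continuous (fun t => Rpower (1 - t ^ 2) (- alpha))).
  unfold Rpower; auto_derive; nra. }
apply (is_derive_RInt (fun t => Rpower (1 - t ^ 2) (- alpha)) _ 0); [|now apply K].
assert (P : 0 < (1 - Rabs x) / 2).
{ assert (Rabs x < 1) by (apply Rabs_def1; lra); lra. }
exists (mkposreal _ P); intros y Hy.
apply (RInt_correct (V := R_CompleteNormedModule)), (ex_RInt_continuous (V := R_CompleteNormedModule)).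
intros t Ht; apply K.
assert (Hy' : Rabs (y - x) < (1 - Rabs x) / 2) by exact Hy.
assert (Rabs y < 1).
{ replace y with ((y - x) + x) by ring; apply Rle_lt_trans with (1 := Rabs_triang _ _); lra. }
apply Rabs_def2 in H; revert Ht; unfold Rmin, Rmax.
destruct (Rle_dec 0 y); lra.
Qed.

Lemma radial_length_increasing (alpha : R) (rho : R -> R) :
  (forall x, -1 < x < 1 -> is_derive rho x (Rpower (1 - x ^ 2) (- alpha))) ->
  forall x y, -1 < x -> x < y -> y < 1 -> rho x < rho y.
Proof.
intros H x y H1 H2 H3.
apply (incr_function rho (-1) 1 (fun x => Rpower (1 - x ^ 2) (- alpha))); simpl; trivial.
- intros t Ht1 Ht2; apply H; lra.
- intros t _ _; apply exp_pos.
Qed.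

Lemma unit_direction (z : C) : exists e, Cmod e = 1 /\ z = (Cmod z * e)%C.
Proof.
destruct (Ceq_dec z 0%C) as [->|H].
- exists 1%C; rewrite Cmod_1, Cmod_0; split; trivial; ring.
- assert (Cmod z <> 0) by (apply Rgt_not_eq; now apply Cmod_gt_0).
  exists (z / Cmod z)%C; split.
  + rewrite Cmod_div by (intros E; apply RtoC_inj in E; contradiction).
    rewrite Cmod_R, Rabs_pos_eq by apply Cmod_ge_0; now field.
  + field; intros E; apply RtoC_inj in E; contradiction.
Qed.

Lemma unit_conj_mult (z : C) : exists c, Cmod c = 1 /\ (c * z)%C = Cmod z.
Proof.
destruct (unit_direction z) as [e [He E]]; exists (Cconj e); split.
- now rewrite Cmod_conj.
- rewrite E at 1; replace (Cconj e * (Cmod z * e))%C with (Cmod z * (e * Cconj e))%C by ring.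
  rewrite <- Cmod2_conj, He; replace (1 ^ 2) with 1 by ring; ring.
Qed.

(** With c rotating phi(z) onto the positive axis, monotonicity along the radius from 0 to z gives
    rho(|phi(z)|) - rho(|z|) <= rho(0) - rho(0), and rho is strictly increasing. *)
Lemma contraction_schwarz (alpha : R) (phi phi' : C -> C) :
  (forall z, disc z -> is_cderive phi z (phi' z)) -> self_map_disc phi ->
  0 < alpha -> phi 0%C = 0%C ->
  (forall z, disc z ->
    Rpower (1 - Cmod z ^ 2) alpha * Cmod (phi' z) <= Rpower (1 - Cmod (phi z) ^ 2) alpha) ->
  forall z, disc z -> Cmod (phi z) <= Cmod z.
Proof.
intros Hd Hs Ha H0 Hc z Hz.
destruct (radial_length_exists alpha) as [rho Hrho].
destruct (unit_direction z) as [e [He E]].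
destruct (unit_conj_mult (phi z)) as [c [Hcm Ec]].
pose proof (Cmod_ge_0 z) as Z0; pose proof (Hs z Hz) as S1; unfold disc in Hz, S1.
pose proof (radial_length_nonincreasing alpha phi phi' rho c e 0 (Cmod z)
  Hd Hs Ha Hc Hrho Hcm He (conj (Rle_refl 0) Z0) Hz) as K.
rewrite <- E, Ec, re_RtoC in K.
replace (0 * e)%C with (RtoC 0) in K by ring.
rewrite H0, Cmult_0_r, re_RtoC in K.
apply Rnot_lt_le; intros L.
pose proof (radial_length_increasing alpha rho Hrho (Cmod z) (Cmod (phi z))); lra.
Qed.

(** * Circle means *)

Lemma Req_of_eps (x y : R) : (forall eps, 0 < eps -> Rabs (x - y) < eps) -> x = y.
Proof.
intros H; destruct (Req_dec x y) as [E|E]; trivial.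
assert (P : 0 < Rabs (x - y)) by (apply Rabs_pos_lt; lra).
specialize (H _ P); lra.
Qed.

(** Continuity of the derivative is included so that g' can be integrated over circles and circle
    integrals differentiated in the radius. *)
Definition hol_C1 (g g' : C -> C) : Prop := forall z, disc z ->
  is_cderive g z (g' z) /\
  continuous (fun w => Re (g' w)) z /\ continuous (fun w => Im (g' w)) z.

Definition cis (t : R) : C := (cos t, sin t).

Lemma Cmod_cis (t : R) : Cmod (cis t) = 1.
Proof.
rewrite <- sqrt_1; unfold Cmod; f_equal; simpl.
pose proof (sin2_cos2 t) as H; unfold Rsqr in H; lra.
Qed.

Lemma cis_surj (e : C) : Cmod e = 1 -> exists t, 0 <= t <= 2 * PI /\ e = cis t.
Proof.
intros He; destruct e as [x y].
assert (H : x² + y² = 1).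
{ pose proof (Cmod2_alt (x, y)) as H; rewrite He in H; simpl in H; unfold Rsqr; lra. }
pose proof PI_RGT_0.
assert (Hx : -1 <= x <= 1) by (unfold Rsqr in H; nra).
pose proof (acos_bound x) as Hb.
assert (Hs : sin (acos x) = sqrt (y²)).
{ rewrite sin_acos by trivial; f_equal; lra. }
rewrite sqrt_Rsqr_abs in Hs.
destruct (Rle_or_lt 0 y) as [Hy|Hy].
- exists (acos x); split; [lra|unfold cis].
  now rewrite Hs, cos_acos, Rabs_pos_eq.
- exists (2 * PI - acos x); split; [lra|unfold cis].
  rewrite cos_minus, sin_minus, cos_2PI, sin_2PI, Hs, cos_acos, Rabs_left by trivial.
  f_equal; ring.
Qed.

Lemma disc_cis (r t : R) : Rabs r < 1 -> disc (r * cis t).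
Proof. intros H; unfold disc; now rewrite Cmod_mult, Cmod_cis, Cmod_R, Rmult_1_r. Qed.

Lemma continuous_polar (r t : R) :
  continuous (fun p : R * R => (fst p * cis (snd p))%C) (r, t).
Proof.
assert (H : forall h : R -> R, (forall s, continuous h s) ->
  continuous (fun p : R * R => fst p * h (snd p)) (r, t)).
{ intros h Hh; apply (continuous_mult (K := R_AbsRing) fst (fun p => h (snd p)));
    [apply continuous_fst|].
  apply continuous_comp; [apply continuous_snd|apply Hh]. }
apply continuous_ext with (fun p : R * R => (fst p * cos (snd p), fst p * sin (snd p))).
- intros p; now rewrite RtoC_mult_pair.
- apply (continuous_comp_2 (fun p : R * R => fst p * cos (snd p))
    (fun p => fst p * sin (snd p)) (fun a b => (a, b))).
  + apply (H cos); intros s; apply continuous_cos.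
  + apply (H sin); intros s; apply continuous_sin.
  + apply continuous_ext with (fun p => p); [now intros []|apply continuous_id].
Qed.

Lemma continuous_polar_comp (u : C -> R) (r t : R) : continuous u (r * cis t)%C ->
  continuous (fun p : R * R => u (fst p * cis (snd p))%C) (r, t).
Proof.
intros H; apply (continuous_comp (fun p : R * R => (fst p * cis (snd p))%C) u).
- apply continuous_polar.
- exact H.
Qed.

Lemma continuous_angle (u : C -> R) (r t : R) : continuous u (r * cis t)%C ->
  continuous (fun s : R => u (r * cis s)%C) t.
Proof.
intros H; apply (continuous_comp_2 (fun _ => r) (fun s => s) (fun a b => u (a * cis b)%C)).
- apply continuous_const.
- apply continuous_id.
- now apply continuous_polar_comp.
Qed.

Lemma is_derive_cis_Re (f : C -> C) (r t : R) (l : C) : is_cderive f (r * cis t)%C l ->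
  is_derive (fun s : R => Re (f (r * cis s)%C)) t (Re (l * (- r * sin t, r * cos t))) /\
  is_derive (fun s : R => Im (f (r * cis s)%C)) t (Im (l * (- r * sin t, r * cos t))).
Proof.
intros H; rewrite RtoC_mult_pair in H.
assert (D1 : is_derive (fun s : R => r * cos s) t (- r * sin t)) by (auto_derive; [easy|ring]).
assert (D2 : is_derive (fun s : R => r * sin s) t (r * cos t)) by (auto_derive; [easy|ring]).
split; eapply is_derive_ext.
- intros s; rewrite RtoC_mult_pair; reflexivity.
- exact (is_derive_Re_curve _ _ _ t _ _ _ H D1 D2).
- intros s; rewrite RtoC_mult_pair; reflexivity.
- exact (is_derive_Im_curve _ _ _ t _ _ _ H D1 D2).
Qed.

(** Cauchy's integral for the first Taylor coefficient of g, in real form: its value is 2 pi r Re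
    (g'(0)). *)
Definition circle_int (g : C -> C) (r : R) : R :=
  RInt (fun t => Re (Cconj (cis t) * g (r * cis t)%C)) 0 (2 * PI).

Definition circle_int_deriv (g' : C -> C) (r : R) : R :=
  RInt (fun t => Re (g' (r * cis t)%C)) 0 (2 * PI).

Lemma continuous_circle_integrand (g g' : C -> C) (Hg : hol_C1 g g') (r t : R) : Rabs r < 1 ->
  continuous (fun t => Re (Cconj (cis t) * g (r * cis t)%C)) t.
Proof.
intros Hr; destruct (Hg _ (disc_cis r t Hr)) as [D _].
destruct (is_derive_cis_Re _ _ _ _ D) as [D1 D2].
apply continuous_ext with
  (fun t => cos t * Re (g (r * cis t)%C) + sin t * Im (g (r * cis t)%C)).
{ intros s; unfold cis; simpl; unfold Re, Im; ring. }
apply (continuous_plus (K := R_AbsRing) (V := R_NormedModule));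
  apply (continuous_mult (K := R_AbsRing)).
- apply continuous_cos.
- apply (ex_derive_continuous (fun s => Re (g (r * cis s)%C))); eexists; exact D1.
- apply continuous_sin.
- apply (ex_derive_continuous (fun s => Im (g (r * cis s)%C))); eexists; exact D2.
Qed.

Lemma ex_circle_int (g g' : C -> C) (Hg : hol_C1 g g') (r : R) : Rabs r < 1 ->
  ex_RInt (fun t => Re (Cconj (cis t) * g (r * cis t)%C)) 0 (2 * PI).
Proof.
intros Hr; apply (ex_RInt_continuous (V := R_CompleteNormedModule)).
intros t _; now apply (continuous_circle_integrand g g' Hg).
Qed.

Lemma ex_circle_int_deriv (g g' : C -> C) (Hg : hol_C1 g g') (r : R) : Rabs r < 1 ->
  ex_RInt (fun t => Re (g' (r * cis t)%C)) 0 (2 * PI).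
Proof.
intros Hr; apply (ex_RInt_continuous (V := R_CompleteNormedModule)).
intros t _; apply (continuous_angle (fun w => Re (g' w))).
now apply Hg, disc_cis.
Qed.

(* Fundamental theorem of calculus for the 2 pi-periodic function
   t |-> Im (exp(-it) g(r exp(it))). *)
Lemma circle_int_eq_deriv (g g' : C -> C) (Hg : hol_C1 g g') (r : R) : Rabs r < 1 -> circle_int g r = r * circle_int_deriv g' r.
Proof.
intros Hr.
set (A t := Re (Cconj (cis t) * g (r * cis t)%C)).
set (B t := Re (g' (r * cis t)%C)).
set (K t := cos t * Im (g (r * cis t)%C) - sin t * Re (g (r * cis t)%C)).
assert (D : forall t, is_derive K t (r * B t - A t)).
{ intros t; destruct (Hg _ (disc_cis r t Hr)) as [D _].
  destruct (is_derive_cis_Re _ _ _ _ D) as [D1 D2].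
  replace (r * B t - A t) with
    ((- sin t * Im (g (r * cis t)%C)
       + cos t * Im (g' (r * cis t)%C * (- r * sin t, r * cos t))) -
     (cos t * Re (g (r * cis t)%C)
       + sin t * Re (g' (r * cis t)%C * (- r * sin t, r * cos t)))).
  - apply (is_derive_minus (K := R_AbsRing) (V := R_NormedModule)
      (fun t => cos t * Im (g (r * cis t)%C)) (fun t => sin t * Re (g (r * cis t)%C))).
    + apply (Derive.is_derive_mult cos); trivial; apply is_derive_cos.
    + apply (Derive.is_derive_mult sin); trivial; apply is_derive_sin.
  - unfold A, B; generalize (g (r * cis t)%C) (g' (r * cis t)%C).
    intros [a b] [a' b']; unfold cis; simpl.
    pose proof (sin2_cos2 t) as S; unfold Rsqr in S.
    transitivity (r * a' * (sin t * sin t + cos t * cos t)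
      - (cos t * a + sin t * b)); [ring|rewrite S; ring]. }
assert (CB : forall t, continuous B t).
{ intros t; apply (continuous_angle (fun w => Re (g' w))); now apply Hg, disc_cis. }
assert (H : is_RInt (fun t => r * B t - A t) 0 (2 * PI) (minus (K (2 * PI)) (K 0))).
{ apply (is_RInt_derive K); intros t _; [apply D|].
  apply (continuous_minus (K := R_AbsRing) (V := R_NormedModule) (fun t => r * B t) A);
    [|now apply (continuous_circle_integrand g g' Hg)].
  apply (continuous_mult (K := R_AbsRing) (fun _ => r) B); [apply continuous_const|apply CB]. }
replace (minus (K (2 * PI)) (K 0)) with 0 in H.
2: { unfold K, cis; rewrite sin_2PI, cos_2PI, sin_0, cos_0; unfold minus, plus, opp; simpl; ring. }
pose proof (is_RInt_minus (V := R_NormedModule) _ _ _ _ _ _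
  (is_RInt_scal (V := R_NormedModule) _ _ _ r _ (RInt_correct _ _ _ (ex_circle_int_deriv g g' Hg r Hr)))
  (RInt_correct _ _ _ (ex_circle_int g g' Hg r Hr))) as H'.
pose proof (is_RInt_unique _ _ _ _ H) as U.
pose proof (is_RInt_unique _ _ _ _ H') as U'.
assert (E : 0 = r * circle_int_deriv g' r - circle_int g r) by (rewrite <- U; exact U').
lra.
Qed.

(** Differentiation under the integral sign; the factor exp(it) produced by the chain rule cancels
    exp(-it) and leaves Re g'. *)
Lemma is_derive_circle_int (g g' : C -> C) (Hg : hol_C1 g g') (r : R) : Rabs r < 1 ->
  is_derive (circle_int g) r (circle_int_deriv g' r).
Proof.
intros Hr.
assert (DR : forall u t : R, Rabs u < 1 ->
  is_derive (fun s : R => Re (Cconj (cis t) * g (s * cis t)%C)) u (Re (g' (u * cis t)%C))).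
{ intros u t Hu.
  replace (Re (g' (u * cis t)%C)) with (Re (Cconj (cis t) * (g' (u * cis t)%C * cis t))).
  - apply is_derive_Re_radius; trivial; [intros z Hz; now apply Hg|apply Cmod_cis].
  - replace (Cconj (cis t) * (g' (u * cis t)%C * cis t))%C
      with (g' (u * cis t)%C * (cis t * Cconj (cis t)))%C by ring.
    rewrite <- Cmod2_conj, Cmod_cis; f_equal.
    replace (1 ^ 2) with 1 by ring; ring. }
assert (L : locally r (fun u => Rabs u < 1)).
{ apply (open_comp Rabs (fun x => x < 1)); trivial.
  - intros x _; apply continuous_Rabs.
  - apply open_lt. }
replace (circle_int_deriv g' r) with
  (RInt (fun t => Derive (fun u : R => Re (Cconj (cis t) * g (u * cis t)%C)) r) 0 (2 * PI)).
2: { apply RInt_ext; intros t _; apply is_derive_unique; now apply DR. }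
apply (is_derive_RInt_param (fun u t : R => Re (Cconj (cis t) * g (u * cis t)%C))).
- apply filter_imp with (2 := L); intros u Hu t _; eexists; now apply DR.
- intros t _; apply continuity_2d_pt_ext_loc with (fun u v => Re (g' (u * cis v)%C)).
  + destruct L as [d Hd]; exists d; intros u v Hu _; symmetry; apply is_derive_unique, DR.
    now apply Hd.
  + apply (continuity_2d_pt_filterlim (fun u v => Re (g' (u * cis v)%C))).
    apply (continuous_polar_comp (fun w => Re (g' w))); now apply Hg, disc_cis.
- apply filter_imp with (2 := L); intros u Hu; now apply (ex_circle_int g g' Hg).
Qed.

(* [I r = r I'(r)], so [I r / r] is constant, equal to its limit at 0. *)
Lemma circle_mean (g g' : C -> C) (Hg : hol_C1 g g') (r : R) : 0 <= r < 1 ->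
  circle_int g r = 2 * PI * r * Re (g' 0%C).
Proof.
intros Hr.
assert (D0 : circle_int_deriv g' 0 = 2 * PI * Re (g' 0%C)).
{ unfold circle_int_deriv; rewrite (RInt_ext _ (fun _ => Re (g' 0%C))).
  - rewrite RInt_const; unfold scal; simpl; unfold mult; simpl; ring.
  - intros t _; now rewrite Cmult_0_l. }
assert (I0 : circle_int g 0 = 0).
{ rewrite (circle_int_eq_deriv g g' Hg), Rmult_0_l; trivial; rewrite Rabs_R0; lra. }
destruct (Req_dec r 0) as [->|Hr0]; [rewrite I0; ring|].
set (k := circle_int g r / r).
assert (Hk : forall s, 0 < s <= r -> circle_int g s = k * s).
{ intros s Hs; destruct (Req_dec s r) as [->|Hne]; [unfold k; now field|].
  assert (E : circle_int g s / s = circle_int g r / r).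
  { apply (eq_is_derive (V := R_NormedModule) (fun x => circle_int g x / x)); [|lra].
    intros t Ht; change (is_derive (fun x => circle_int g x / x) t 0).
    replace 0 with ((circle_int_deriv g' t * t - circle_int g t * 1) / t ^ 2).
    - apply (is_derive_div (circle_int g) (fun x => x)); [| |lra].
      + apply (is_derive_circle_int g g' Hg); rewrite Rabs_pos_eq; lra.
      + apply (is_derive_id (K := R_AbsRing)).
    - rewrite (circle_int_eq_deriv g g' Hg) by (rewrite Rabs_pos_eq; lra).
      field; lra. }
  unfold k; rewrite <- E; field; lra. }
(* The integral is k s on (0, r] and 0 at s = 0, so its right difference quotients at 0 are all k,
   while its derivative there is known. *)
assert (K0 : k = circle_int_deriv g' 0).
{ assert (H0 : Rabs 0 < 1) by (rewrite Rabs_R0; lra).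
  pose proof (proj1 (is_derive_Reals _ _ _) (is_derive_circle_int g g' Hg 0 H0)) as D.
  apply Req_of_eps; intros eps Heps.
  destruct (D eps Heps) as [d Hd].
  assert (Hd0 := cond_pos d).
  set (h := Rmin (d / 2) r).
  assert (Hh : 0 < h <= r /\ h < d).
  { unfold h; split; [split; [apply Rmin_pos; lra|apply Rmin_r]|].
    apply Rle_lt_trans with (1 := Rmin_l _ _); lra. }
  destruct Hh as [Hh1 Hh2].
  specialize (Hd h ltac:(lra) ltac:(rewrite Rabs_pos_eq; lra)).
  rewrite Rplus_0_l, I0, Hk in Hd by trivial.
  replace ((k * h - 0) / h) with k in Hd by (field; lra).
  exact Hd. }
rewrite (Hk r) by lra; rewrite K0, D0; ring.
Qed.

(** * Isometries are rotations *)

Lemma RInt_zero_nonneg (f : R -> R) (a b t : R) :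
  (forall x, continuous f x) -> (forall x, 0 <= f x) -> RInt f a b = 0 ->
  a <= t < b -> f t = 0.
Proof.
intros Hc Hp H0 Ht.
assert (Hex : forall x y, ex_RInt f x y)
  by (intros x y; apply (ex_RInt_continuous (V := R_CompleteNormedModule)); intros; apply Hc).
(* Nonnegativity of both pieces forces every partial integral to vanish; its right difference
   quotients at t are then 0, which is where t < b matters. *)
assert (G0 : forall x, a <= x <= b -> RInt f a x = 0).
{ intros x Hx.
  pose proof (RInt_ge_0 f a x (proj1 Hx) (Hex _ _) (fun y _ => Hp y)).
  pose proof (RInt_ge_0 f x b (proj2 Hx) (Hex _ _) (fun y _ => Hp y)).
  assert (E : RInt f a x + RInt f x b = RInt f a b)
    by apply (RInt_Chasles f a x b (Hex _ _) (Hex _ _)).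
  lra. }
assert (D : is_derive (RInt f a) t (f t)).
{ apply (is_derive_RInt f _ a); [|apply Hc].
  apply filter_forall; intros y; apply (RInt_correct f), Hex. }
apply is_derive_Reals in D.
symmetry; apply Req_of_eps; intros eps Heps.
destruct (D eps Heps) as [d Hd]; pose proof (cond_pos d).
set (h := Rmin (d / 2) (b - t)).
assert (Hh : 0 < h <= b - t /\ h < d).
{ unfold h; split; [split; [apply Rmin_pos; lra|apply Rmin_r]|].
  apply Rle_lt_trans with (1 := Rmin_l _ _); lra. }
specialize (Hd h ltac:(lra) ltac:(rewrite Rabs_pos_eq; lra)).
rewrite !G0 in Hd by lra.
now replace ((0 - 0) / h) with 0 in Hd by (field; lra).
Qed.

Lemma hol_C1_scal (c : C) (g g' : C -> C) :
  hol_C1 g g' -> hol_C1 (fun z => c * g z)%C (fun z => c * g' z)%C.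
Proof.
intros H z Hz; destruct (H z Hz) as [H1 [H2 H3]]; split; [|split].
- now apply is_cderive_scal.
- apply continuous_ext with (fun w => Re c * Re (g' w) - Im c * Im (g' w));
    [reflexivity|].
  apply (continuous_minus (V := R_NormedModule) (fun w => Re c * Re (g' w)) (fun w => Im c * Im (g' w)));
    apply (continuous_mult (K := R_AbsRing)); trivial; apply continuous_const.
- apply continuous_ext with (fun w => Re c * Im (g' w) + Im c * Re (g' w));
    [reflexivity|].
  apply (continuous_plus (V := R_NormedModule) (fun w => Re c * Im (g' w)) (fun w => Im c * Re (g' w)));
    apply (continuous_mult (K := R_AbsRing)); trivial; apply continuous_const.
Qed.

Lemma circle_integrand_le (g : C -> C) (r t M : R) :
  Cmod (g (r * cis t)%C) <= M -> Re (Cconj (cis t) * g (r * cis t)%C) <= M.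
Proof.
intros H; apply Rle_trans with (1 := Rle_abs _).
apply Rle_trans with (1 := Rabs_Re_le _).
now rewrite Cmod_mult, Cmod_conj, Cmod_cis, Rmult_1_l.
Qed.

(** After rotating g'(0) onto the positive axis, the circle mean equals r |g'(0)| and its integrand
    is at most 1; then r tends to 1. *)
Lemma self_map_deriv0_le (g g' : C -> C) :
  hol_C1 g g' -> self_map_disc g -> Cmod (g' 0%C) <= 1.
Proof.
intros Hg Hs; destruct (unit_conj_mult (g' 0%C)) as [c [Hc E]].
pose proof (hol_C1_scal c _ _ Hg) as Hcg.
assert (K : forall r, 0 <= r < 1 -> r * Cmod (g' 0%C) <= 1).
{ intros r Hr; pose proof (circle_mean _ _ Hcg r Hr) as M.
  cbv beta in M; rewrite E, re_RtoC in M.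
  assert (L : circle_int (fun z => c * g z)%C r <= RInt (fun _ => 1) 0 (2 * PI)).
  { pose proof PI_RGT_0; apply RInt_le; [lra| |apply ex_RInt_const|].
    - apply (ex_circle_int _ _ Hcg); rewrite Rabs_pos_eq; lra.
    - intros t _; apply (circle_integrand_le (fun z => c * g z)%C).
      rewrite Cmod_mult, Hc, Rmult_1_l; apply Rlt_le, Hs, disc_cis.
      rewrite Rabs_pos_eq; lra. }
  rewrite RInt_const in L; unfold scal in L; simpl in L; unfold mult in L; simpl in L.
  pose proof PI_RGT_0; nra. }
apply Rnot_lt_le; intros H.
set (m := Cmod (g' 0%C)) in *.
assert (Hi : / m < 1) by (rewrite <- Rinv_1; apply Rinv_lt_contravar; lra).
assert (Hi0 : 0 < / m) by (apply Rinv_0_lt_compat; lra).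
(* A radius strictly between 1/m and 1: there r m = (m + 1) / 2 > 1. *)
pose proof (K ((1 + / m) / 2) ltac:(lra)) as K1.
replace ((1 + / m) / 2 * m) with ((m + 1) / 2) in K1 by (field; lra); lra.
Qed.

(** On the circle of radius r, the mean of Re (exp(-it) c g) is r while the integrand never exceeds
    r. It is therefore r everywhere, which determines g(z) for each z on that circle. *)
Lemma schwarz_equality (g g' : C -> C) :
  hol_C1 g g' -> (forall z, disc z -> Cmod (g z) <= Cmod z) ->
  Cmod (g' 0%C) = 1 -> rotation_disc g.
Proof.
intros Hg Hle H1; destruct (unit_conj_mult (g' 0%C)) as [c [Hc E]].
rewrite H1 in E.
pose proof (hol_C1_scal c _ _ Hg) as Hcg.
exists (Cconj c); split; [now rewrite Cmod_conj|].
intros z Hz; destruct (unit_direction z) as [e [He Ez]].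
destruct (cis_surj e He) as [t0 [Ht0 Et0]].
(* The vanishing lemma excludes the right end point, so the angle 2 pi is replaced by 0. *)
assert (exists t, 0 <= t < 2 * PI /\ e = cis t) as [t [Ht Et]].
{ destruct (Req_dec t0 (2 * PI)) as [->|]; [|exists t0; split; trivial; lra].
  exists 0; pose proof PI_RGT_0; split; [lra|].
  rewrite Et0; unfold cis; now rewrite cos_2PI, sin_2PI, cos_0, sin_0. }
set (r := Cmod z) in *.
assert (Hr : 0 <= r < 1) by (split; [apply Cmod_ge_0|exact Hz]).
assert (Hr' : Rabs r < 1) by (rewrite Rabs_pos_eq; lra).
pose proof (circle_mean _ _ Hcg r Hr) as M; cbv beta in M; rewrite E, re_RtoC in M.
set (F t := Re (Cconj (cis t) * (c * g (r * cis t))%C)).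
assert (Gle : forall t, Cmod (c * g (r * cis t)%C) <= r).
{ intros s; rewrite Cmod_mult, Hc, Rmult_1_l.
  apply Rle_trans with (1 := Hle _ (disc_cis r s Hr')).
  rewrite Cmod_mult, Cmod_cis, Cmod_R, Rabs_pos_eq; lra. }
assert (EF : r - F t = 0).
{ apply (RInt_zero_nonneg (fun s => r - F s) 0 (2 * PI)); trivial.
  - intros s; apply (continuous_minus (V := R_NormedModule) (fun _ => r) F);
      [apply continuous_const|now apply (continuous_circle_integrand _ _ Hcg)].
  - intros s; pose proof (circle_integrand_le (fun z => c * g z)%C r s r (Gle s)).
    unfold F; lra.
  - assert (K : RInt (fun s => r - F s) 0 (2 * PI) = RInt (fun _ => r) 0 (2 * PI) - RInt F 0 (2 * PI)).
    { apply (RInt_minus (V := R_CompleteNormedModule) (fun _ => r) F);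
        [apply ex_RInt_const|now apply (ex_circle_int _ _ Hcg)]. }
    rewrite K, RInt_const; change (RInt F 0 (2 * PI)) with (circle_int (fun z => c * g z)%C r).
    rewrite M; unfold scal; simpl; unfold mult; simpl; ring. }
specialize (Gle t); unfold F in EF; rewrite <- Et, <- Ez in EF, Gle.
(* A number of modulus at most r with real part r has no imaginary part. *)
assert (W : (Cconj e * (c * g z))%C = r).
{ set (w := (Cconj e * (c * g z))%C) in *.
  assert (Hw : Cmod w <= r)
    by (unfold w; rewrite Cmod_mult, Cmod_conj, He; lra).
  pose proof (Cmod2_alt w) as A; pose proof (Cmod_ge_0 w).
  assert (B : Im w = 0) by nra.
  destruct w as [x y]; simpl in *; unfold RtoC; f_equal; lra. }
rewrite Ez at 2; rewrite <- W.
replace (Cconj c * (Cconj e * (c * g z) * e))%C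
  with ((c * Cconj c) * (e * Cconj e) * g z)%C by ring.
rewrite <- !Cmod2_conj, Hc, He; replace (1 ^ 2) with 1 by ring; ring.
Qed.

(** * Disc automorphisms and the Schwarz-Pick bound *)

Lemma is_cderive_quadratic (f : C -> C) (z l : C) (K : R) (d : posreal) :
  (forall w, Cmod (w - z) < d -> Cmod (f w - f z - (w - z) * l) <= K * Cmod (w - z) ^ 2) ->
  is_cderive f z l.
Proof.
intros H; split; [apply (is_linear_scal_l (V := AbsRing_NormedModule C_AbsRing) l)|].
intros x Hx eps.
apply (is_filter_lim_locally_unique (K := C_AbsRing)
  (V := AbsRing_NormedModule C_AbsRing)) in Hx; subst x.
set (K' := Rmax K 1).
assert (HK : 1 <= K') by apply Rmax_r.
assert (HKK : K <= K') by apply Rmax_l.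
pose proof (cond_pos eps); pose proof (cond_pos d).
assert (P : 0 < Rmin d (eps / K')).
{ apply Rmin_pos; trivial; apply Rdiv_lt_0_compat; lra. }
exists (mkposreal _ P); intros w Hw.
assert (Hw' : Cmod (w - z) < Rmin d (eps / K')) by exact Hw.
assert (W1 : Cmod (w - z) < d) by (apply Rlt_le_trans with (1 := Hw'), Rmin_l).
assert (W2 : Cmod (w - z) < eps / K') by (apply Rlt_le_trans with (1 := Hw'), Rmin_r).
apply Rle_trans with (1 := H w W1).
pose proof (Cmod_ge_0 (w - z)).
change (K * Cmod (w - z) ^ 2 <= eps * Cmod (w - z)).
assert (K' * Cmod (w - z) <= eps).
{ apply Rmult_le_reg_r with (/ K'); [apply Rinv_0_lt_compat; lra|].
  replace (K' * Cmod (w - z) * / K') with (Cmod (w - z)) by (field; lra).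
  unfold Rdiv in W2; lra. }
nra.
Qed.

Lemma is_cderive_inv (z : C) : z <> 0%C -> is_cderive Cinv z (- (/ z * / z))%C.
Proof.
intros Hz; pose proof (proj1 (Cmod_gt_0 z) Hz) as Hm.
(* The remainder is exactly (w - z)^2 / (w z^2), and |w| > |z| / 2 on the chosen ball. *)
apply (is_cderive_quadratic _ _ _ (2 / Cmod z ^ 3) (mkposreal (Cmod z / 2) ltac:(lra))).
simpl; intros w Hw.
assert (Hwm : Cmod z / 2 < Cmod w).
{ pose proof (Cmod_triangle w (- (w - z))) as T; rewrite Cmod_opp in T.
  replace (w + - (w - z))%C with z in T by ring; lra. }
assert (Hw0 : w <> 0%C) by (intros ->; rewrite Cmod_0 in Hwm; lra).
replace (/ w - / z - (w - z) * - (/ z * / z))%C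
  with ((w - z) * (w - z) * (/ w * (/ z * / z)))%C by (field; now split).
rewrite !Cmod_mult, !Cmod_inv by trivial.
replace (Cmod (w - z) * Cmod (w - z) * (/ Cmod w * (/ Cmod z * / Cmod z)))
  with (/ Cmod w * (/ Cmod z * / Cmod z) * Cmod (w - z) ^ 2) by ring.
apply Rmult_le_compat_r; [apply pow2_ge_0|].
apply Rle_trans with (/ (Cmod z / 2) * (/ Cmod z * / Cmod z));
  [|apply Req_le; field; lra].
apply Rmult_le_compat_r.
- apply Rmult_le_pos; apply Rlt_le, Rinv_0_lt_compat; lra.
- apply Rlt_le, Rinv_lt_contravar; trivial.
  apply Rmult_lt_0_compat; lra.
Qed.

Lemma continuous_comp_C (f : C -> C) (u : C -> R) (z : C) :
  continuous (fun w => Re (f w)) z -> continuous (fun w => Im (f w)) z ->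
  continuous u (f z) -> continuous (fun w => u (f w)) z.
Proof.
intros H1 H2 H3.
apply continuous_ext with (fun w => u (Re (f w), Im (f w)));
  [intros w; now destruct (f w)|].
apply (continuous_comp_2 (fun w => Re (f w)) (fun w => Im (f w)) (fun a b => u (a, b))); trivial.
apply continuous_ext with u; [now intros []|].
destruct (f z); exact H3.
Qed.

Lemma continuous_Im_cderive (f : C -> C) (z l : C) :
  is_cderive f z l -> continuous (fun w => Im (f w)) z.
Proof.
intros H; apply (is_cderive_scal (- Ci)) in H.
apply continuous_Re_cderive in H.
eapply continuous_ext; [|exact H]; intros w; cbv beta; rewrite re_mult, re_opp, im_opp; simpl; ring.
Qed.

Lemma hol_C1_comp (f f' g g' g'' : C -> C) :
  hol_C1 f f' -> self_map_disc g ->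
  (forall z, disc z -> is_cderive g z (g' z) /\ is_cderive g' z (g'' z)) ->
  hol_C1 (fun z => f (g z)) (fun z => g' z * f' (g z))%C.
Proof.
intros Hf Hs Hg z Hz; destruct (Hg z Hz) as [G1 G2].
destruct (Hf (g z) (Hs z Hz)) as [F1 [F2 F3]].
pose proof (continuous_Re_cderive _ _ _ G1) as C1.
pose proof (continuous_Im_cderive _ _ _ G1) as C2.
pose proof (continuous_Re_cderive _ _ _ G2) as C3.
pose proof (continuous_Im_cderive _ _ _ G2) as C4.
pose proof (continuous_comp_C g (fun w => Re (f' w)) z C1 C2 F2) as C5.
pose proof (continuous_comp_C g (fun w => Im (f' w)) z C1 C2 F3) as C6.
split; [|split].
- apply (is_derive_comp (K := C_AbsRing) (V := AbsRing_NormedModule C_AbsRing) f g); trivial.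
- apply (continuous_minus (V := R_NormedModule)
    (fun w => Re (g' w) * Re (f' (g w))) (fun w => Im (g' w) * Im (f' (g w))));
    now apply (continuous_mult (K := R_AbsRing)).
- apply (continuous_plus (V := R_NormedModule)
    (fun w => Re (g' w) * Im (f' (g w))) (fun w => Im (g' w) * Re (f' (g w))));
    now apply (continuous_mult (K := R_AbsRing)).
Qed.

Lemma disc_den_neq0 (a z : C) : disc a -> disc z -> (1 + Cconj a * z)%C <> 0%C.
Proof.
unfold disc; intros Ha Hz E.
assert (M : Cmod (Cconj a * z) < 1).
{ rewrite Cmod_mult, Cmod_conj.
  pose proof (Cmod_ge_0 a); pose proof (Cmod_ge_0 z); nra. }
replace (Cconj a * z)%C with (- (1))%C in M.
- rewrite Cmod_m1 in M; lra.
- replace (Cconj a * z)%C with ((1 + Cconj a * z) - 1)%C by ring; rewrite E; ring.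
Qed.

Lemma self_map_mobius (a : C) : disc a ->
  self_map_disc (fun z => (z + a) * / (1 + Cconj a * z))%C.
Proof.
intros Ha z Hz; pose proof (disc_den_neq0 a z Ha Hz) as Hn.
unfold disc; rewrite Cmod_mult, Cmod_inv by trivial.
pose proof (proj1 (Cmod_gt_0 _) Hn) as Hp.
apply Rmult_lt_reg_r with (1 := Hp).
rewrite Rmult_assoc, Rinv_l, Rmult_1_r, Rmult_1_l by lra.
apply Rsqr_incrst_0; [|apply Cmod_ge_0|lra].
rewrite !Rsqr_pow2, !Cmod2_alt.
pose proof (Cmod_sq_lt1 a Ha) as A; pose proof (Cmod_sq_lt1 z Hz) as B.
rewrite Cmod2_alt in A, B.
(* The inequality rests on |1 + conj(a) z|^2 - |z + a|^2 = (1 - |a|^2)(1 - |z|^2) > 0. *)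
destruct a as [a1 a2], z as [x y]; simpl in *; nra.
Qed.

Lemma is_cderive_affine (b c z : C) : is_cderive (fun w => b + c * w)%C z c.
Proof.
assert (H : is_cderive (fun w => b + c * w)%C z (0 + c * 1)%C).
{ apply (is_derive_plus (K := C_AbsRing) (V := AbsRing_NormedModule C_AbsRing) (fun _ => b)).
  - apply (is_derive_const (K := C_AbsRing) (V := AbsRing_NormedModule C_AbsRing)).
  - apply (is_cderive_scal c (fun w => w)), (is_derive_id (K := C_AbsRing)). }
now replace (0 + c * 1)%C with c in H by ring.
Qed.

(** The bound on the derivative at 0 is applied to g composed with the automorphism T, for which
    T(0) = a and T'(0) = 1 - |a|^2. The second derivative of T serves to make T' continuous. *)
Lemma weak_schwarz_pick (g g' : C -> C) (a : C) :
  hol_C1 g g' -> self_map_disc g -> disc a ->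
  (1 - Cmod a ^ 2) * Cmod (g' a) <= 1.
Proof.
intros Hg Hs Ha.
set (V z := (/ (1 + Cconj a * z))%C).
set (V' z := (Cconj a * - (V z * V z))%C).
assert (DV : forall z, disc z -> is_cderive V z (V' z)).
{ intros z Hz; apply (is_derive_comp (K := C_AbsRing) (V := AbsRing_NormedModule C_AbsRing)
    Cinv (fun z => 1 + Cconj a * z)%C).
  - now apply is_cderive_inv, disc_den_neq0.
  - apply is_cderive_affine. }
assert (DM : forall (p q : C -> C) (z p' q' : C), is_cderive p z p' -> is_cderive q z q' ->
  is_cderive (fun w => p w * q w)%C z (p' * q z + p z * q')%C)
  by (intros; apply (is_derive_mult (K := C_AbsRing)); trivial; exact Cmult_comm).
assert (DT : forall z : C, is_cderive (fun w => w + a)%C z (RtoC 1)).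
{ intros z; eapply is_derive_ext; [|apply (is_cderive_affine a 1)].
  intros w; cbv beta; rewrite Cmult_1_l; apply Cplus_comm. }
set (T z := ((z + a) * V z)%C).
set (T' z := (1 * V z + (z + a) * V' z)%C).
assert (H : exists T'', forall z, disc z -> is_cderive T z (T' z) /\ is_cderive T' z (T'' z)).
{ exists (fun z => 1 * V' z + (1 * V' z + (z + a) *
    (Cconj a * - (V' z * V z + V z * V' z))))%C; intros z Hz; split.
  - now apply (DM (fun w => w + a)%C V); [|apply DV].
  - apply (is_derive_plus (K := C_AbsRing) (V := AbsRing_NormedModule C_AbsRing)
      (fun z => 1 * V z)%C (fun z => (z + a) * V' z)%C).
    + now apply (is_cderive_scal 1 V), DV.
    + apply (DM (fun w => w + a)%C V'); [apply DT|].
      apply (is_cderive_scal (Cconj a) (fun z => - (V z * V z))%C).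
      apply (is_derive_opp (K := C_AbsRing) (V := AbsRing_NormedModule C_AbsRing)
        (fun z => V z * V z)%C).
      now apply (DM V V); apply DV. }
destruct H as [T'' H].
assert (ST : self_map_disc T) by now apply self_map_mobius.
pose proof (self_map_deriv0_le _ _ (hol_C1_comp _ _ _ _ _ Hg ST H)
  (fun z Hz => Hs _ (ST z Hz))) as K; cbv beta in K.
assert (V0 : V 0%C = 1%C) by (unfold V; field; rewrite Cmult_0_r, Cplus_0_r; apply C1_nz).
replace (T 0%C) with a in K by (unfold T; rewrite V0; ring).
replace (T' 0%C) with (RtoC (1 - Cmod a ^ 2)) in K.
2: { unfold T', V'; rewrite V0, RtoC_minus, Cmod2_conj; ring. }
rewrite Cmod_mult, Cmod_R, Rabs_pos_eq in K; trivial.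
pose proof (Cmod_sq_lt1 a Ha); lra.
Qed.

(** * The derivative at 0 for alpha > 1 *)

Lemma continuous_Cmod (f : C -> C) (z : C) :
  continuous (fun w => Re (f w)) z -> continuous (fun w => Im (f w)) z ->
  continuous (fun w => Cmod (f w)) z.
Proof.
intros H1 H2.
apply (continuous_comp (fun w => Re (f w) ^ 2 + Im (f w) ^ 2) sqrt); [|apply continuous_sqrt].
apply (continuous_plus (V := R_NormedModule) (fun w => Re (f w) ^ 2) (fun w => Im (f w) ^ 2)).
- apply continuous_ext with (fun w => Re (f w) * Re (f w));
    [intros w; change (Re (f w) * Re (f w) = Re (f w) ^ 2); ring|].
  now apply (continuous_mult (K := R_AbsRing) (fun w => Re (f w)) (fun w => Re (f w))).
- apply continuous_ext with (fun w => Im (f w) * Im (f w));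
    [intros w; change (Im (f w) * Im (f w) = Im (f w) ^ 2); ring|].
  now apply (continuous_mult (K := R_AbsRing) (fun w => Im (f w)) (fun w => Im (f w))).
Qed.

Lemma isometry_deriv0_gt1 (alpha : R) (phi phi' : C -> C) :
  1 < alpha -> hol_C1 phi phi' -> self_map_disc phi ->
  isometry_HB alpha (comp_op phi) -> phi 0%C = 0%C -> 1 <= Cmod (phi' 0%C).
Proof.
intros Ha Hh Hs Hi H0; apply Rnot_lt_le; intros Hk.
set (k := Cmod (phi' 0%C)) in *.
destruct (Hh 0%C disc_0) as [_ [C1 C2]].
pose proof (continuous_Cmod _ _ C1 C2) as CM.
assert (P : 0 < (1 - k) / 2) by lra.
destruct (proj1 (filterlim_locally _ _) CM (mkposreal _ P)) as [d Hd].
set (d' := Rmin d (1 / 2)).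
assert (Hd' : 0 < d' /\ d' <= d /\ d' <= 1 / 2).
{ unfold d'; pose proof (cond_pos d); split; [apply Rmin_pos; lra|split; [apply Rmin_l|apply Rmin_r]]. }
destruct Hd' as [D1 [D2 D3]].
(* The first bound serves on |z| < d', where |phi'| stays near k by continuity; the second serves on
   |z| >= d' by Schwarz-Pick. As M < 1, this contradicts the density 1 of the identity function at
   0. *)
set (M := Rmax ((1 + k) / 2) (Rpower (1 - d' ^ 2) (alpha - 1))).
assert (HM : M < 1).
{ apply Rmax_lub_lt; [lra|].
  replace 1 with (Rpower 1 (alpha - 1)) at 3
    by (unfold Rpower; rewrite ln_1, Rmult_0_r; apply exp_0).
  apply Rlt_Rpower_l; [lra|nra]. }
apply (Rlt_not_le 1 M); trivial.
assert (Ha' : 0 < alpha) by lra.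
pose proof (proj1 (isometry_seminorm_le _ _ _ M Hi H0
    (HB_test_fun alpha 0 0 0 0 Ha' (Rle_refl 0)))) as K.
cut (bloch_density alpha (test_fun 0 0 0 0) 0 <= M).
{ rewrite density_test_fun, Cmod_0 by lra.
  replace (1 - 0 ^ 2) with 1 by ring; unfold Rpower; rewrite ln_1, Rmult_0_r, exp_0; simpl; lra. }
apply K; [|apply disc_0].
intros z Hz; rewrite (density_test_fun_comp _ _ _ _ _ _ z (phi' z)) by (try lra; now apply Hh).
replace (_ ^ 0 + 0 * _ ^ 0) with 1 by (simpl; ring); rewrite Rmult_1_r.
pose proof (Cmod_sq_lt1 z Hz) as Z1; pose proof (Cmod_ge_0 z) as Z0.
pose proof (Cmod_ge_0 (phi' z)) as Z2.
destruct (Rlt_or_le (Cmod z) d') as [L|L].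
- apply Rle_trans with ((1 + k) / 2); [|apply Rmax_l].
  assert (B : ball (RtoC 0 : C_UniformSpace) d z).
  { apply C_NormedModule_mixin_compat1; replace (minus z (RtoC 0)) with z; [lra|].
    change (z = z - 0)%C; ring. }
  specialize (Hd z B).
  assert (Hd2 : Rabs (Cmod (phi' z) - k) < (1 - k) / 2) by exact Hd.
  apply Rabs_def2 in Hd2.
  pose proof (Rpower_le_1 _ alpha Z1 (Rlt_le _ _ Ha')).
  pose proof (exp_pos (alpha * ln (1 - Cmod z ^ 2))).
  unfold Rpower in *; nra.
- apply Rle_trans with (Rpower (1 - d' ^ 2) (alpha - 1)); [|apply Rmax_r].
  apply Rle_trans with (Rpower (1 - Cmod z ^ 2) (alpha - 1)).
  + replace alpha with ((alpha - 1) + 1) at 1 by ring.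
    rewrite Rpower_plus, Rpower_1 by lra.
    pose proof (weak_schwarz_pick _ _ z Hh Hs Hz).
    pose proof (exp_pos ((alpha - 1) * ln (1 - Cmod z ^ 2))).
    unfold Rpower in *; nra.
  + apply Rle_Rpower_l; [lra|nra].
Qed.

(** * The derivative at 0 for alpha < 1 *)

Lemma isometry_sup_one (alpha : R) (phi phi' : C -> C) (S : R) :
  0 < alpha -> (forall z, disc z -> is_cderive phi z (phi' z)) -> self_map_disc phi ->
  isometry_HB alpha (comp_op phi) -> phi 0%C = 0%C ->
  0 < S < 1 -> exists z, disc z /\ S < Cmod (phi z).
Proof.
intros Ha Hd Hs Hi H0 HS; apply Classical_Prop.NNPP; intros N.
assert (B : forall z, disc z -> Cmod (phi z) <= S).
{ intros z Hz; apply Rnot_lt_le; intros L; apply N; now exists z. }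
pose proof (isometry_contracts _ _ _ Ha Hd Hs Hi H0) as Hc.
set (t := (1 + S) / 2); assert (Ht : S < t < 1) by (unfold t; lra).
(* If |phi| <= S, contraction bounds the density of phi^(n+1)/(n+1) by S^n, while that of
   z^(n+1)/(n+1) at a point t > S decays only like t^n. For large n, (S/t)^n falls below the fixed
   weight at t. *)
assert (K : forall n, Rpower (1 - t ^ 2) alpha * t ^ n <= S ^ n).
{ intros n.
  pose proof (proj1 (isometry_seminorm_le _ _ _ (S ^ n) Hi H0
    (HB_test_fun alpha 0 n 0 0 Ha (Rle_refl 0)))) as K.
  cut (bloch_density alpha (test_fun 0 n 0 0) t <= S ^ n).
  { rewrite density_test_fun, Cmod_R, Rabs_pos_eq by lra; lra. }
  apply K; [|unfold disc; rewrite Cmod_R, Rabs_pos_eq; lra].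
  intros z Hz; rewrite (density_test_fun_comp _ _ _ _ _ _ z (phi' z)) by (try lra; auto).
  rewrite Rmult_0_l, Rplus_0_r, <- (Rmult_1_l (S ^ n)).
  pose proof (Cmod_ge_0 (phi z)); pose proof (B z Hz).
  apply Rmult_le_compat.
  - apply Rmult_le_pos; [apply Rlt_le, exp_pos|apply Cmod_ge_0].
  - now apply pow_le.
  - apply Rle_trans with (1 := Hc z Hz), Rpower_le_1; [|lra].
    now apply Cmod_sq_lt1, Hs.
  - now apply pow_incr. }
assert (Hq : 0 <= S / t < 1).
{ split; [apply Rmult_le_pos; [lra|apply Rlt_le, Rinv_0_lt_compat; lra]|].
  apply Rmult_lt_reg_r with t; [lra|]; unfold Rdiv; rewrite Rmult_assoc, Rinv_l; lra. }
destruct (pow_lt_1_zero (S / t) ltac:(rewrite Rabs_pos_eq; lra)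
  (Rpower (1 - t ^ 2) alpha) (exp_pos _)) as [n Hn].
specialize (Hn n (le_n n)); specialize (K n).
rewrite Rabs_pos_eq in Hn by (now apply pow_le).
assert (Pt : 0 < t ^ n) by (apply pow_lt; lra).
apply (Rmult_lt_compat_r _ _ _ Pt) in Hn.
rewrite <- Rpow_mult_distr in Hn; replace (S / t * t) with S in Hn by (field; lra).
lra.
Qed.

(** On [0, 1) one has (1 - y^2)^(-alpha) <= (1 - y)^(-alpha), whose integral over [0, 1) is 1 / (1 -
    alpha). *)
Lemma radial_length_bounded (alpha : R) (rho : R -> R) : 0 < alpha < 1 ->
  (forall x, -1 < x < 1 -> is_derive rho x (Rpower (1 - x ^ 2) (- alpha))) ->
  forall x, 0 <= x < 1 -> rho x <= rho 0 + / (1 - alpha).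
Proof.
intros Ha H x Hx.
set (N y := rho y + / (1 - alpha) * Rpower (1 - y) (1 - alpha)).
set (dN y := Rpower (1 - y ^ 2) (- alpha) - Rpower (1 - y) (- alpha)).
assert (D : forall y, -1 < y < 1 -> is_derive N y (dN y)).
{ intros y Hy.
  apply (is_derive_plus (K := R_AbsRing) (V := R_NormedModule) rho
    (fun y => / (1 - alpha) * Rpower (1 - y) (1 - alpha)));
    [now apply H|].
  change (is_derive (fun y => / (1 - alpha) * Rpower (1 - y) (1 - alpha)) y
    (- Rpower (1 - y) (- alpha))).
  assert (D : is_derive (fun y => Rpower (1 - y) (1 - alpha)) y
    ((1 - alpha) * - / (1 - y) * Rpower (1 - y) (1 - alpha))).
  { unfold Rpower; auto_derive; [lra|].
    replace (1 + - y) with (1 - y) by ring; field; lra. }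
  apply (is_derive_scal _ _ (/ (1 - alpha))) in D.
  replace (- Rpower (1 - y) (- alpha)) with (/ (1 - alpha) *
    ((1 - alpha) * - / (1 - y) * Rpower (1 - y) (1 - alpha))); trivial.
  replace (Rpower (1 - y) (1 - alpha)) with (Rpower (1 - y) (- alpha + 1))
    by (f_equal; ring).
  rewrite Rpower_plus, Rpower_1 by lra; field; lra. }
assert (L : N x <= N 0).
{ destruct (Req_dec x 0) as [->|Hne]; [lra|].
  destruct (MVT_gen N 0 x dN) as [c [Hc E]].
  - intros y Hy; rewrite Rmin_left, Rmax_right in Hy by lra; apply D; lra.
  - intros y Hy; rewrite Rmin_left, Rmax_right in Hy by lra.
    apply continuity_pt_filterlim, (ex_derive_continuous N); exists (dN y); apply D; lra.
  - rewrite Rmin_left, Rmax_right in Hc by lra.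
    assert (dN c <= 0).
    { unfold dN; rewrite !Rpower_Ropp.
      assert (/ Rpower (1 - c ^ 2) alpha <= / Rpower (1 - c) alpha); [|lra].
      apply Rinv_le_contravar; [apply exp_pos|apply Rle_Rpower_l; [lra|nra]]. }
    nra. }
unfold N in L.
assert (0 <= / (1 - alpha) * Rpower (1 - x) (1 - alpha)).
{ apply Rmult_le_pos; [apply Rlt_le, Rinv_0_lt_compat; lra|apply Rlt_le, exp_pos]. }
replace (Rpower (1 - 0) (1 - alpha)) with 1 in L; [lra|].
rewrite Rminus_0_r; unfold Rpower; now rewrite ln_1, Rmult_0_r, exp_0.
Qed.

Lemma isometry_deriv0_lt1 (alpha : R) (phi phi' : C -> C) :
  0 < alpha < 1 -> (forall z, disc z -> is_cderive phi z (phi' z)) ->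
  self_map_disc phi ->
  isometry_HB alpha (comp_op phi) -> phi 0%C = 0%C -> 1 <= Cmod (phi' 0%C).
Proof.
intros Ha Hd Hs Hi H0; apply Rnot_lt_le; intros Hk.
assert (Ha' : 0 < alpha) by lra.
pose proof (isometry_contracts _ _ _ Ha' Hd Hs Hi H0) as Hc.
pose proof (contraction_schwarz _ _ _ Hd Hs Ha' H0 Hc) as Hsch.
destruct (radial_length_exists alpha) as [rho Hrho].
pose proof (radial_length_increasing alpha rho Hrho) as Hinc.
set (k := Cmod (phi' 0%C)) in *.
assert (P : 0 < (1 - k) / 2) by lra.
destruct (is_cderive_eps _ _ _ (Hd 0%C disc_0) (mkposreal _ P)) as [d Hdd]; simpl in Hdd.
set (r := Rmin (d / 2) (1 / 2)).
assert (Hr : 0 < r /\ r < d /\ r < 1).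
{ unfold r; pose proof (cond_pos d); split; [apply Rmin_pos; lra|split].
  - apply Rle_lt_trans with (1 := Rmin_l _ _); lra.
  - apply Rle_lt_trans with (1 := Rmin_r _ _); lra. }
set (m := (1 + k) / 2).
pose proof (Cmod_ge_0 (phi' 0%C)) as Hk0; fold k in Hk0.
assert (Hm : 0 <= m < 1) by (unfold m; lra).
(* If |phi'(0)| = k < 1, the midpoint m of k and 1 is a contraction factor on a small circle: the
   error (1 - k)/2 per unit length is added to k. *)
assert (Hphi : forall w, Cmod w = r -> Cmod (phi w) <= m * r).
{ intros w Hw; specialize (Hdd w).
  replace (w - 0)%C with w in Hdd by ring; rewrite Hw, H0 in Hdd.
  specialize (Hdd ltac:(lra)).
  replace (phi w) with ((phi w - 0 - w * phi' 0%C) + w * phi' 0%C)%C by ring.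
  apply Rle_trans with (1 := Cmod_triangle _ _).
  rewrite (Cmod_mult w), Hw; fold k; unfold m; lra. }
set (E := fun y => exists x, 0 <= x < 1 /\ y = rho x).
destruct (completeness E) as [L [HL1 HL2]].
- exists (rho 0 + / (1 - alpha)); intros y [x [Hx ->]].
  now apply (radial_length_bounded alpha).
- exists (rho 0), 0; split; [lra|easy].
(* The deficit [rho r - rho (m * r)] is lost at radius r and cannot be regained further out.
   Choosing S within this deficit of the total length L makes an image point beyond S impossible. *)
- assert (Heta : rho (m * r) < rho r) by (apply Hinc; nra).
  assert (exists S, 0 < S < 1 /\ r <= S /\ L - (rho r - rho (m * r)) < rho S) as [S [HS1 [HS2 HS3]]].
  { apply Classical_Prop.NNPP; intros N.
    assert (L <= L - (rho r - rho (m * r))); [|lra].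
    apply HL2; intros y [x [Hx ->]]; apply Rnot_lt_le; intros HN; apply N.
    (* Since |z| >= |phi(z)| > S, requiring S >= r ensures that the radius to z crosses the circle
       of radius r. *)
    exists (Rmax x r).
    assert (M1 := Rmax_l x r); assert (M2 := Rmax_r x r).
    assert (M3 : Rmax x r < 1) by (apply Rmax_lub_lt; lra).
    repeat split; try lra.
    destruct (Req_dec x (Rmax x r)) as [Em|Em]; [rewrite <- Em; lra|].
    pose proof (Hinc x (Rmax x r)); lra. }
  destruct (isometry_sup_one _ _ _ S Ha' Hd Hs Hi H0 HS1) as [z [Hz1 Hz2]].
  pose proof (Hsch z Hz1) as Hz3.
  pose proof (Hs z Hz1) as Hz4; unfold disc in Hz1, Hz4.
  destruct (unit_direction z) as [e [He Ez]].
  destruct (unit_conj_mult (phi z)) as [c [Hcm Ec]].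
  pose proof (radial_length_nonincreasing alpha phi phi' rho c e r (Cmod z)
    Hd Hs Ha' Hc Hrho Hcm He ltac:(lra) Hz1) as K.
  rewrite <- Ez, Ec, re_RtoC in K.
  assert (U1 : rho (Cmod z) <= L) by (apply HL1; exists (Cmod z); split; trivial; lra).
  assert (U2 : rho S < rho (Cmod (phi z))) by (apply Hinc; lra).
  assert (Hre : Cmod (r * e) = r) by (rewrite Cmod_mult, Cmod_R, He, Rabs_pos_eq; lra).
  pose proof (Hphi _ Hre) as Q1.
  set (q := Re (c * phi (r * e)%C)) in *.
  assert (Q2 : Rabs q <= m * r).
  { apply Rle_trans with (2 := Q1); unfold q.
    apply Rle_trans with (1 := Rabs_Re_le _); rewrite Cmod_mult, Hcm; lra. }
  assert (Q3 : -1 < q <= m * r).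
  { pose proof (Rle_abs q); pose proof (Rle_abs (- q)) as Q; rewrite Rabs_Ropp in Q; nra. }
  destruct (Req_dec q (m * r)) as [Eq|Nq]; [rewrite Eq in K; lra|].
  pose proof (Hinc q (m * r)); nra.
Qed.

(** [analytic_disc] asserts only pointwise differentiability. Continuity of the derivative is read
    off from phi being the image of z, hence harmonic and so C^1; [deriv_x] is the complex
    derivative written with the partial derivatives whose continuity is then known. *)
Lemma isometry_hol_C1 (alpha : R) (phi : C -> C) :
  0 < alpha -> analytic_disc phi -> isometry_HB alpha (comp_op phi) ->
  hol_C1 phi (deriv_x phi).
Proof.
intros Ha Hphi Hi z Hz.
assert (E : comp_op phi (test_fun 0 0 0 0) = phi).
{ apply functional_extensionality; intros w; unfold comp_op, test_fun.
  destruct (phi w); unfold Cconj, Cplus, Cmult; simpl; f_equal; field. }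
destruct (Hi _ (HB_test_fun alpha 0 0 0 0 Ha (Rle_refl 0))) as [[[[C1 _] [[C2 _] _]] _] _].
rewrite E in C1, C2.
destruct (Hphi z Hz) as [l Hl]; apply is_cderive_of_NormedModule in Hl.
destruct (partial_Re _ _ _ Hl) as [D1 _]; destruct (partial_Im _ _ _ Hl) as [D2 _].
split; [|split; [apply (C1 z Hz)|apply (C2 z Hz)]].
replace (deriv_x phi z) with l; trivial.
destruct l as [a b]; unfold deriv_x, partial_x; f_equal; symmetry;
  apply is_derive_unique; assumption.
Qed.

Lemma isometry_rotation (alpha : R) (phi : C -> C) :
  0 < alpha -> alpha <> 1 -> analytic_disc phi -> self_map_disc phi ->
  isometry_HB alpha (comp_op phi) -> rotation_disc phi.
Proof.
intros Ha Ha1 Hphi Hs Hi.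
pose proof (isometry_hol_C1 _ _ Ha Hphi Hi) as Hh.
assert (Hd : forall z, disc z -> is_cderive phi z (deriv_x phi z))
  by (intros z Hz; now apply Hh).
pose proof (isometry_fix0 _ _ Ha (fun z Hz => ex_intro _ _ (Hd z Hz)) Hi) as H0.
pose proof (isometry_contracts _ _ _ Ha Hd Hs Hi H0) as Hc.
apply (schwarz_equality _ _ Hh).
- now apply (contraction_schwarz alpha _ _ Hd Hs Ha H0).
- apply Rle_antisym; [now apply (self_map_deriv0_le phi)|].
  destruct (Rtotal_order alpha 1) as [L|[L|L]]; [|contradiction|].
  + now apply (isometry_deriv0_lt1 alpha phi).
  + now apply (isometry_deriv0_gt1 alpha phi).
Qed.

(** * Rotations are isometries *)

Lemma locally_disc (z : C) : disc z -> locally z disc.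
Proof.
intros Hz; apply (open_comp Cmod (fun x => x < 1)); [|apply open_lt|exact Hz].
intros w _; apply (continuous_Cmod (fun w => w) w);
  [apply continuous_fst|apply continuous_snd].
Qed.

(** A rotation mixes the two variables, so the chain rule needs a total differential, not just
    partial derivatives. *)
Lemma C1_disc_differentiable (u : C -> R) (z : C) : C1_disc u -> disc z ->
  differentiable_pt_lim (fun x y => u (x, y)) (Re z) (Im z) (partial_x u z) (partial_y u z).
Proof.
intros Hu Hz; apply filterdiff_differentiable_pt_lim.
destruct (Hu z Hz) as [_ [Hy [Cx _]]].
destruct z as [x y].
apply (is_derive_filterdiff (fun x y => u (x, y)) x y (fun x y => partial_x u (x, y))).
- apply filter_imp with (2 := locally_disc _ Hz); intros [a b] Hab.
  apply (Derive_correct (fun t => u (t, b))), (Hu (a, b) Hab).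
- exact (Derive_correct _ _ Hy).
- apply continuous_ext with (2 := Cx); now intros [].
Qed.

(** The partial derivatives of a rotated function are rotated combinations of this kind, so this
    carries the first-order rotation lemma to second order. *)
Lemma C1_disc_lincomb (u v : C -> R) (a b : R) : C1_disc u -> C1_disc v ->
  C1_disc (fun z => a * u z + b * v z) /\
  forall z, disc z ->
    partial_x (fun z => a * u z + b * v z) z = a * partial_x u z + b * partial_x v z /\
    partial_y (fun z => a * u z + b * v z) z = a * partial_y u z + b * partial_y v z.
Proof.
intros Hu Hv.
assert (D : forall (p q : R -> R) t, ex_derive p t -> ex_derive q t ->
  is_derive (fun s => a * p s + b * q s) t (a * Derive p t + b * Derive q t)).
{ intros p q t Hp Hq.
  apply (is_derive_plus (K := R_AbsRing) (V := R_NormedModule) (fun s => a * p s) (fun s => b * q s));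
    apply is_derive_scal; now apply Derive_correct. }
assert (P : forall z, disc z ->
    is_derive (fun t => a * u (t, Im z) + b * v (t, Im z)) (Re z)
      (a * partial_x u z + b * partial_x v z) /\
    is_derive (fun t => a * u (Re z, t) + b * v (Re z, t)) (Im z)
      (a * partial_y u z + b * partial_y v z)).
{ intros z Hz; destruct (Hu z Hz) as [U1 [U2 _]], (Hv z Hz) as [V1 [V2 _]].
  split; [now apply (D (fun t => u (t, Im z)) (fun t => v (t, Im z)))
         |now apply (D (fun t => u (Re z, t)) (fun t => v (Re z, t)))]. }
assert (E : forall z, disc z ->
    partial_x (fun z => a * u z + b * v z) z = a * partial_x u z + b * partial_x v z /\
    partial_y (fun z => a * u z + b * v z) z = a * partial_y u z + b * partial_y v z)
  by (intros z Hz; destruct (P z Hz); split; now apply is_derive_unique).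
split; trivial; intros z Hz.
destruct (Hu z Hz) as [_ [_ [U3 U4]]], (Hv z Hz) as [_ [_ [V3 V4]]].
split; [|split; [|split]].
- eexists; apply (P z Hz).
- eexists; apply (P z Hz).
- apply continuous_ext_loc with (fun z => a * partial_x u z + b * partial_x v z).
  + apply filter_imp with (2 := locally_disc z Hz); intros w Hw; symmetry; now apply E.
  + apply (continuous_plus (V := R_NormedModule) (fun z => a * partial_x u z) (fun z => b * partial_x v z));
      apply (continuous_mult (K := R_AbsRing)); trivial; apply continuous_const.
- apply continuous_ext_loc with (fun z => a * partial_y u z + b * partial_y v z).
  + apply filter_imp with (2 := locally_disc z Hz); intros w Hw; symmetry; now apply E.
  + apply (continuous_plus (V := R_NormedModule) (fun z => a * partial_y u z) (fun z => b * partial_y v z));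
      apply (continuous_mult (K := R_AbsRing)); trivial; apply continuous_const.
Qed.

Lemma disc_rotate (l z : C) : Cmod l = 1 -> disc z -> disc (l * z).
Proof. unfold disc; intros Hl Hz; now rewrite Cmod_mult, Hl, Rmult_1_l. Qed.

Lemma continuous_rotate (l z : C) (u : C -> R) :
  continuous u (l * z)%C -> continuous (fun w => u (l * w)%C) z.
Proof.
pose proof (is_cderive_scal l _ _ _ (is_derive_id (K := C_AbsRing) z)) as D.
intros H; apply (continuous_comp_C (fun w => l * w)%C); trivial.
- exact (continuous_Re_cderive _ _ _ D).
- exact (continuous_Im_cderive _ _ _ D).
Qed.

(** The relation between u and v is assumed on the disc alone: phi is prescribed only there, and the
    partial derivatives of v, to which the lemma is applied again, are computed only there. *)
Lemma C1_disc_rotate (l : C) (u v : C -> R) : Cmod l = 1 -> C1_disc u ->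
  (forall w, disc w -> v w = u (l * w)%C) ->
  C1_disc v /\ forall z, disc z ->
    partial_x v z = Re l * partial_x u (l * z)%C + Im l * partial_y u (l * z)%C /\
    partial_y v z = - Im l * partial_x u (l * z)%C + Re l * partial_y u (l * z)%C.
Proof.
intros Hl Hu Hv.
assert (P : forall z, disc z ->
    is_derive (fun t => v (t, Im z)) (Re z)
      (Re l * partial_x u (l * z)%C + Im l * partial_y u (l * z)%C) /\
    is_derive (fun t => v (Re z, t)) (Im z)
      (- Im l * partial_x u (l * z)%C + Re l * partial_y u (l * z)%C)).
{ intros z Hz; pose proof (locally_disc z Hz) as Hloc.
  apply partial_of_differentiable.
  assert (D := C1_disc_differentiable u _ Hu (disc_rotate l z Hl Hz)).
  assert (LE : forall p q x y : R,
    differentiable_pt_lim (fun s t => p * s + q * t) x y p q).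
  { intros p q x y eps; exists eps; intros s t _ _.
    replace (_ - _ - _) with 0 by ring; rewrite Rabs_R0.
    apply Rmult_le_pos; [apply Rlt_le, cond_pos|].
    apply Rle_trans with (1 := Rabs_pos (s - x)), Rmax_l. }
  pose proof (differentiable_pt_lim_comp (fun x y => u (x, y))
    (fun s t => Re l * s + (- Im l) * t) (fun s t => Im l * s + Re l * t)
    (Re z) (Im z) (partial_x u (l * z)%C) (partial_y u (l * z)%C) (Re l) (- Im l) (Im l) (Re l))
    as K.
  replace (Re l * partial_x u (l * z)%C + Im l * partial_y u (l * z)%C)
    with (partial_x u (l * z)%C * Re l + partial_y u (l * z)%C * Im l) by ring.
  replace (- Im l * partial_x u (l * z)%C + Re l * partial_y u (l * z)%C)
    with (partial_x u (l * z)%C * - Im l + partial_y u (l * z)%C * Re l) by ring.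
  eapply differentiable_pt_lim_ext; [|apply K; [|apply LE|apply LE]].
  - destruct Hloc as [d Hd]; exists d; intros s t Hs Ht; rewrite Hv.
    + f_equal; destruct l as [a b]; unfold Cmult; simpl; f_equal; ring.
    + apply Hd; destruct z; split; assumption.
  - replace (Re l * Re z + - Im l * Im z) with (Re (l * z)) by (simpl; unfold Re, Im; ring).
    replace (Im l * Re z + Re l * Im z) with (Im (l * z)) by (simpl; unfold Re, Im; ring).
    exact D. }
assert (E : forall z, disc z ->
    partial_x v z = Re l * partial_x u (l * z)%C + Im l * partial_y u (l * z)%C /\
    partial_y v z = - Im l * partial_x u (l * z)%C + Re l * partial_y u (l * z)%C)
  by (intros z Hz; destruct (P z Hz); split; now apply is_derive_unique).
split; trivial; intros z Hz.
destruct (Hu _ (disc_rotate l z Hl Hz)) as [_ [_ [U3 U4]]].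
apply continuous_rotate in U3; apply continuous_rotate in U4.
split; [|split; [|split]].
- eexists; apply (P z Hz).
- eexists; apply (P z Hz).
- apply continuous_ext_loc with
    (fun z => Re l * partial_x u (l * z)%C + Im l * partial_y u (l * z)%C).
  + apply filter_imp with (2 := locally_disc z Hz); intros w Hw; symmetry; now apply E.
  + apply (continuous_plus (V := R_NormedModule) (fun z => Re l * partial_x u (l * z)%C)
      (fun z => Im l * partial_y u (l * z)%C));
      apply (continuous_mult (K := R_AbsRing)); trivial; apply continuous_const.
- apply continuous_ext_loc with
    (fun z => - Im l * partial_x u (l * z)%C + Re l * partial_y u (l * z)%C).
  + apply filter_imp with (2 := locally_disc z Hz); intros w Hw; symmetry; now apply E.
  + apply (continuous_plus (V := R_NormedModule) (fun z => - Im l * partial_x u (l * z)%C)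
      (fun z => Re l * partial_y u (l * z)%C));
      apply (continuous_mult (K := R_AbsRing)); trivial; apply continuous_const.
Qed.

Lemma C2_disc_rotate (l : C) (u v : C -> R) : Cmod l = 1 -> C2_disc u ->
  (forall w, disc w -> v w = u (l * w)%C) ->
  C2_disc v /\ forall z, disc z -> laplacian v z = laplacian u (l * z)%C.
Proof.
intros Hl [Hu [Hux Huy]] Hv.
destruct (C1_disc_rotate l u v Hl Hu Hv) as [Cv Ev].
destruct (C1_disc_lincomb _ _ (Re l) (Im l) Hux Huy) as [Cx Ex].
destruct (C1_disc_lincomb _ _ (- Im l) (Re l) Hux Huy) as [Cy Ey].
destruct (C1_disc_rotate l _ (partial_x v) Hl Cx (fun w Hw => proj1 (Ev w Hw))) as [Cvx Evx].
destruct (C1_disc_rotate l _ (partial_y v) Hl Cy (fun w Hw => proj2 (Ev w Hw))) as [Cvy Evy].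
split; [now split|]; intros z Hz.
pose proof (disc_rotate l z Hl Hz) as Hlz.
unfold laplacian; rewrite (proj1 (Evx z Hz)), (proj2 (Evy z Hz)).
destruct (Ex _ Hlz) as [-> ->]; destruct (Ey _ Hlz) as [-> ->].
pose proof (Cmod2_alt l) as M; rewrite Hl in M.
set (p := partial_x (partial_x u) _); set (q := partial_y (partial_y u) _).
set (s := partial_x (partial_y u) _); set (t := partial_y (partial_x u) _).
(* The coefficients of the two mixed derivatives [s] and [t] cancel separately. *)
transitivity ((Re l ^ 2 + Im l ^ 2) * (p + q)); [ring|rewrite <- M; ring].
Qed.

Lemma deriv_rotate (l : C) (f g : C -> C) (z : C) : Cmod l = 1 -> harmonic_disc f ->
  (forall w, disc w -> g w = f (l * w)%C) -> disc z ->
  deriv_z g z = (l * deriv_z f (l * z)%C)%C /\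
  deriv_zbar g z = (Cconj l * deriv_zbar f (l * z)%C)%C.
Proof.
intros Hl [[H1 _] [[H2 _] _]] Hg Hz.
destruct (proj2 (C1_disc_rotate l _ (fun w => Re (g w)) Hl H1
  (fun w Hw => f_equal Re (Hg w Hw))) z Hz) as [A1 A2].
destruct (proj2 (C1_disc_rotate l _ (fun w => Im (g w)) Hl H2
  (fun w Hw => f_equal Im (Hg w Hw))) z Hz) as [B1 B2].
unfold deriv_z, deriv_zbar, deriv_x, deriv_y; rewrite A1, A2, B1, B2.
destruct l as [a b].
split; unfold Cmult, Cminus, Cplus, Copp, Cinv, Ci, Cconj, RtoC; simpl; f_equal; field.
Qed.

Lemma rotation_isometry (alpha : R) (phi : C -> C) :
  rotation_disc phi -> isometry_HB alpha (comp_op phi).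
Proof.
intros [l [Hl Hphi]] f [Hh Hf].
assert (Hg : forall w, disc w -> comp_op phi f w = f (l * w)%C)
  by (intros w Hw; unfold comp_op; now rewrite Hphi).
assert (E : bloch_norm alpha (comp_op phi f) = bloch_norm alpha f).
{ assert (D : forall z, disc z ->
    bloch_density alpha (comp_op phi f) z = bloch_density alpha f (l * z)%C).
  { intros z Hz; unfold bloch_density.
    destruct (deriv_rotate l f _ z Hl Hh Hg Hz) as [-> ->].
    now rewrite !Cmod_mult, Cmod_conj, Hl, !Rmult_1_l. }
  rewrite !bloch_norm_eq, Hg, Cmult_0_r by apply disc_0; f_equal.
  apply Lub_Rbar_eqset; intros r; split; intros [z [Hz ->]].
  - exists (l * z)%C; split; [now apply disc_rotate|now apply D].
  (* The conjugate of l is its inverse, so every point of the disc is reached and no value of the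
     density is lost. *)
  - assert (Hz' : disc (Cconj l * z)) by (apply disc_rotate; trivial; now rewrite Cmod_conj).
    exists (Cconj l * z)%C; split; trivial; rewrite D by trivial; f_equal.
    replace (l * (Cconj l * z))%C with (l * Cconj l * z)%C by ring.
    rewrite <- Cmod2_conj, Hl; replace (1 ^ 2) with 1 by ring; ring. }
split; trivial; split; [|now rewrite E].
destruct Hh as [H1 [H2 H3]].
destruct (C2_disc_rotate l _ (fun w => Re (comp_op phi f w)) Hl H1
  (fun w Hw => f_equal Re (Hg w Hw))) as [A1 A2].
destruct (C2_disc_rotate l _ (fun w => Im (comp_op phi f w)) Hl H2
  (fun w Hw => f_equal Im (Hg w Hw))) as [B1 B2].
split; [exact A1|split; [exact B1|]].
intros z Hz; rewrite A2, B2 by trivial; now apply H3, disc_rotate.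
Qed.

Theorem theorem2p3 (alpha : R) (phi : C -> C)
  (phi_analytic : analytic_disc phi) (phi_self : self_map_disc phi)
  (alpha_pos : 0 < alpha) (alpha_neq1 : alpha <> 1) :
  isometry_HB alpha (comp_op phi) <-> rotation_disc phi.
Proof.
split; [now apply isometry_rotation|apply rotation_isometry].
Qed.
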